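(* Let $n \geq 2$, let $f:S^{n-1} \to \{0,1\}$ be measurable, let $0 \leq \rho < 1$, and let $(\mathbf{x},\mathbf{y})$ be $\rho$-correlated points on the unit sphere $S^{n-1} \subseteq \mathbb{R}^n$. Let $\eta$ be a halfspace such that $\mathbb{E}_{\mathbf{x} \sim S^{n-1}}[1_{\eta}(\mathbf{x})] = \mathbb{E}_{\mathbf{x} \sim S^{n-1}}[f(\mathbf{x})]$, where $1_\eta$ is the indicator of $\eta$ and $\mathbf{x}\sim S^{n-1}$ denotes a uniformly random point of $S^{n-1}$. Then \[ -H(f(\mathbf{x}) \mid \mathbf{y}) \leq -H(1_{\eta}(\mathbf{x}) \mid \mathbf{y}). \]
   Context: $\rho$-correlated points on $S^{n-1}$: $\mathbf{x}$ is uniformly distributed on $S^{n-1}$ and $\mathbf{y}$ is the first point of $S^{n-1}$ hit by a standard $n$-dimensional Brownian motion started at $\rho\mathbf{x}$ (equivalently, the result of running Brownian motion on $S^{n-1}$ for time $\ln(1/\rho)$ started at $\mathbf{x}$). Equivalently, for $g:S^{n-1}\to\mathbb{R}$, $P_\rho g(x) := \mathbb{E}[g(\mathbf{y}) \mid \mathbf{x} = x] = \mathbb{E}_{\mathbf{y} \sim S^{n-1}}[P_\rho(x,\mathbf{y}) g(\mathbf{y})]$ with Poisson kernel $P_\rho(x,y) = \frac{1-\rho^2}{\|x-\rho y\|^n}$. For $\beta\in[0,1]$, $h(\beta) = \beta\log_2(1/\beta) + (1-\beta)\log_2(1/(1-\beta))$. For $\{0,1\}$-valued $g$, $H(g(\mathbf{x})\mid\mathbf{y})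 = \mathbb{E}_{\mathbf{y}}[h(\Pr[g(\mathbf{x})=1\mid \mathbf{y}])]$, and $-H(g(\mathbf{x})\mid\mathbf{y}) = \mathbb{E}_{\mathbf{x}\sim S^{n-1}}[-h(P_\rho g(\mathbf{x}))]$. A halfspace is a set $\{x \in \mathbb{R}^n : \langle a,x\rangle \geq t\}$ with $a\neq 0$, $t\in\mathbb{R}$. *)

(* Defs.v *)
From HB Require Import structures.
From mathcomp Require Import all_boot all_order all_algebra.
From mathcomp Require Import all_classical all_reals all_analysis.
Set Implicit Arguments. Unset Strict Implicit. Unset Printing Implicit Defensive.
Import Order.TTheory GRing.Theory Num.Theory.
Import numFieldNormedType.Exports.
Local Open Scope classical_set_scope.
Local Open Scope ring_scope.

Section Defs.
Variable R : realType.

Definition dotv n (a x : 'rV[R]_n) : R := \sum_(i < n) a 0 i * x 0 i.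
Definition enorm n (x : 'rV[R]_n) : R := Num.sqrt (dotv x x).

Definition sphere n : set 'rV[R]_n := [set x | enorm x = 1].
Definition uball n : set 'rV[R]_n := [set x | enorm x < 1].
Arguments sphere n : clear implicits.
Arguments uball n : clear implicits.

Definition borelRn n : set (set 'rV[R]_n) := <<s [set A : set 'rV[R]_n | open A] >>.
Arguments borelRn n : clear implicits.
Definition measurable_on_sphere n (f : 'rV[R]_n -> R) : Prop :=
  forall B : set R, measurable B -> borelRn n (sphere n `&` f @^-1` B).

(* Lebesgue integral over R^n of a nonnegative function, as the iterated
   (Tonelli) integral of one-dimensional Lebesgue integrals.
   [iint k F] integrates coordinates 0..k-1. *)
Fixpoint iint (k : nat) (F : (nat -> R) -> \bar R) : \bar R :=
  match k with
  | 0 => F (fun _ => 0)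
  | k'.+1 => (\int[@lebesgue_measure R]_t
                iint k' (fun x => F (fun i => if i == k' then t else x i)))%E
  end.
Definition lebint n (G : 'rV[R]_n -> \bar R) : \bar R :=
  iint n (fun x => G (\row_(i < n) x i)).

(* Expectation of g(x) for x uniform on S^{n-1}, via the cone measure:
   E[g] = (1/vol(B)) * int_B g(x/|x|) dx. *)
Definition sphereE n (g : 'rV[R]_n -> R) : \bar R :=
  (lebint (fun x => (\1_(uball n) x * g ((enorm x)^-1 *: x))%:E)
   * ((fine (lebint (fun x => (\1_(uball n) x : R)%:E)))^-1)%:E)%E.

Definition poisson_kernel n (rho : R) (x y : 'rV[R]_n) : R :=
  (1 - rho ^+ 2) / (enorm (x - rho *: y)) ^+ n.
Definition Prho n (rho : R) (g : 'rV[R]_n -> R) (x : 'rV[R]_n) : R :=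
  fine (sphereE (fun y => poisson_kernel rho x y * g y)).

Definition binent (b : R) : R :=
  if (0 < b) && (b < 1) then
    (b * (- ln b) + (1 - b) * (- ln (1 - b))) / ln 2
  else 0.

(* H(g(x) | y) for rho-correlated (x,y) on the sphere:
   E_y[ h(Pr[g(x)=1 | y]) ] = E_x[ h(P_rho g(x)) ] *)
Definition condH n (rho : R) (g : 'rV[R]_n -> R) : \bar R :=
  sphereE (fun x => binent (Prho rho g x)).

Definition is_halfspace n (eta : set 'rV[R]_n) : Prop :=
  exists (a : 'rV[R]_n) (t : R), a != 0 /\ eta = [set x | t <= dotv a x].

End Defs.
Arguments sphere {R} n.
Arguments uball {R} n.
Arguments borelRn {R} n.

(* Main.v *)
Require Import Defs.
From HB Require Import structures.
From mathcomp Require Import all_boot all_order all_algebra.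
From mathcomp Require Import all_classical all_reals all_analysis.
From mathcomp Require Import measurable_realfun ring lra.
Set Implicit Arguments. Unset Strict Implicit. Unset Printing Implicit Defensive.
Import Order.TTheory GRing.Theory Num.Theory.
Import numFieldNormedType.Exports.
Local Open Scope classical_set_scope.
Local Open Scope ring_scope.

(**
Polarization. For a unit vector [u], two-point symmetrization moves the larger of
[f x], [f (s x)] ([s] the reflection in [u]) to the half of the sphere where [<x,u> >= 0].
As the Poisson kernel decreases with the distance, the smoothed function [P f] becomes
larger on that half while [P f x + P f (s x)] is unchanged, so by convexity of [-h] the
energy [E (-h (P f))] does not decrease.  Let [e] be the pole of the cap.  Among the sets of
the same measure and no smaller energy choose [g] that almost maximizes [E (g(y) <y,e>)]:
no polarization towards [e] gains much, and since the kernel is Lipschitz this forces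
[P g], hence [q = P (-h' (P g))], to be almost increasing in [<x,e>], with no compactness
argument.  The tangent inequality gives [energy cap - energy g >= E (q * (cap - g))],
which is almost nonnegative by the bathtub principle.

The entropy is only meaningful on [0, 1], so the Poisson kernel has to have mass one.
With [d = 1 + r^2 - 2 r s], invariance under reflections near a fixed one gives an
integration by parts formula on the sphere; hence [r^(n-1) E ((r - s) d^(-n/2))] is
constant in [r], so zero, hence [E d^(-(n-2)/2)] is constant, so one, and the two
combine to [(1 - r^2) E d^(-n/2) = 1].
*)

(** * Borel structure *)

(** The iterated integral behind [sphereE] is readily invariant under translations but not under
    rotations. Reflection invariance, on which both polarization and the mass computation rest,
    therefore has to be won from the uniqueness of Haar measure. Almost monotonicity comes from one
    quantity, [D = E (<y,u> (g^u y - g y))], where [g^u] is the polarization of [g]: the height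
    grows by exactly [<u,e> * D], while [P g^u - P g] is at most [L * D] on the sphere. A height
    within [eps] of the supremum thus bounds the failure of [P g] to be monotone by
    [L * eps / <u,e>]. This bound is useless for points of nearly equal height, so a strip of width
    [r] below the cap is given up; [eps] tends to 0 at fixed [r], and [r] afterwards. The slope of
    [-h] is infinite at 0 and 1. The kernel is bounded below by a positive constant, so for sets of
    a given measure strictly between 0 and 1 all smoothed functions stay in a common [[c, 1 - c]],
    where the slope is Lipschitz. Measures 0 and 1 are settled apart. *)

(* The measurable sets are definitionally those of [borelRn n]. *)
HB.instance Definition _ (R : realType) n := Measurable.copy 'rV[R]_n
  (g_sigma_algebraType (@open 'rV[R]_n)).

Section MeasurableRow.
Variables (R : realType) (n : nat).
Local Notation V := 'rV[R]_n.

Lemma open_measurable_rV (A : set V) : open A -> measurable A.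
Proof. by move=> oA; exact: sub_sigma_algebra. Qed.

Lemma continuous_measurable_rV (f : V -> R) : continuous f -> measurable_fun setT f.
Proof.
move=> cf; apply: (measurability _ (RGenOInfty.measurableE R)).
move=> _ [_ [a ->] <-]; rewrite setTI; apply: open_measurable_rV.
by apply: open_comp => // x _; exact: cf.
Qed.

Lemma measurable_coord (i : 'I_n) : measurable_fun setT (fun x : V => x 0 i).
Proof. by apply: continuous_measurable_rV; exact: coord_continuous. Qed.

Lemma measurable_rV_ball d (T : measurableType d) (g : T -> V) (q : V) (e : R) :
  (forall i, measurable_fun setT (fun t => g t 0 i)) ->
  measurable [set t | forall i, `|q 0 i - g t 0 i| < e].
Proof.
move=> mg.
rewrite (_ : mkset _ = \bigcap_(i in [set: 'I_n]) [set t | `|q 0 i - g t 0 i| < e]);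
  last by apply/seteqP; split=> [t h i _ | t h i]; [exact: h|exact: (h i)].
apply: fin_bigcap_measurable => // i _.
rewrite (_ : mkset _ = setT `&` (fun t => `|q 0 i - g t 0 i|) @^-1` `]-oo, e[); last first.
  by apply/seteqP; split=> t /=; rewrite in_itv //= => -[].
have : measurable_fun setT (fun t => `|q 0 i - g t 0 i|).
  apply: measurableT_comp => //; apply: measurable_funB => //.
by apply => //; exact: measurable_itv.
Qed.

(* Every open set is a countable union of rational boxes. *)
Lemma measurable_fun_rV d (T : measurableType d) (g : T -> V) :
  (forall i, measurable_fun setT (fun t => g t 0 i)) -> measurable_fun setT g.
Proof.
move=> mg; apply: (measurability (@open V)) => //.
move=> _ [U oU <-]; rewrite setTI.
pose q (p : 'rV[rat]_n * nat) : V := map_mx ratr p.1.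
pose b (p : 'rV[rat]_n * nat) : set V :=
  [set y | forall i, `|q p 0 i - y 0 i| < p.2.+1%:R^-1].
rewrite (_ : _ @^-1` _ =
  \bigcup_(p in [set: 'rV[rat]_n * nat]) (g @^-1` (if `[< b p `<=` U >] then b p else set0))).
  apply: countable_bigcupT_measurable; first exact: countableP.
  move=> p; case: ifP => _; last by rewrite preimage_set0.
  exact: measurable_rV_ball.
apply/seteqP; split=> [t Ut|t [p _]]; last first.
  by case: ifPn => //= /asboolP bU tb; exact: bU.
have /nbhs_ballP[e /= e0 eU] : nbhs (g t) U by exact: open_nbhs_nbhs.
(* A box of half-width below [e / 2] that contains [g t] stays inside the ball of radius [e] about
   it. *)
pose k := Num.truncn (2 / e).
have ke : k.+1%:R^-1 < e / 2.
  rewrite -[e / 2]invrK ltf_pV2 ?posrE ?invr_gt0 ?divr_gt0//.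
  by rewrite invf_div; exact: truncnS_gt.
have ki0 : 0 < k.+1%:R^-1 :> R by rewrite invr_gt0.
have hr i : exists r : rat, `|ratr r - g t 0 i| < k.+1%:R^-1.
  have /rat_in_itvoo[r] : g t 0 i - k.+1%:R^-1 < g t 0 i + k.+1%:R^-1.
    by rewrite ltrD2l (lt_trans _ ki0)// oppr_lt0.
  by rewrite in_itv/= => /andP[r1 r2]; exists r; rewrite ltr_distl r1 r2.
pose r := \row_i projT1 (cid (hr i)).
have qr i : q (r, k) 0 i = ratr (projT1 (cid (hr i))) by rewrite /q !mxE.
exists (r, k) => //=.
have bU : b (r, k) `<=` U.
  move=> y yb; apply: eU; split => // i j; rewrite (ord1 i).
  have := yb j; rewrite /= qr; case: (cid _) => /= s; set z := g t 0 j.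
  rewrite /ball/= => h1 h2.
  rewrite (_ : z - y 0 j = (z - ratr s) + (ratr s - y 0 j)); last by ring.
  rewrite (le_lt_trans (ler_normD _ _))// (distrC z).
  rewrite [e](_ : _ = e / 2 + e / 2); last by field.
  by apply: ltrD; exact: lt_trans ke.
case: ifPn => [_|/asboolP//] i /=.
by rewrite qr; case: (cid _).
Qed.

End MeasurableRow.

(** * Lebesgue measure on row vectors *)

Definition pushforward_measure d1 d2 (T1 : measurableType d1) (T2 : measurableType d2) (R : realType)
  (m : {measure set T1 -> \bar R}) (f : T1 -> T2) (mf : measurable_fun setT f) :
  {measure set T2 -> \bar R} :=
  measure_function_pushforward__canonical__measure_function_Measure m mf.

Lemma integral_pushforward_measure d1 d2 (T1 : measurableType d1) (T2 : measurableType d2)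
  (R : realType) (m : {measure set T1 -> \bar R}) (f : T1 -> T2)
  (mf : measurable_fun setT f) (g : T2 -> \bar R) :
  measurable_fun setT g -> (forall x, 0 <= g x)%E ->
  (\int[pushforward_measure m mf]_y g y = \int[m]_x g (f x))%E.
Proof.
by move=> mg g0; rewrite [LHS](ge0_integral_pushforward mf) ?preimage_setT.
Qed.

Section LebesgueRow.
Variables (R : realType).
Local Notation leb := (@lebesgue_measure R).

(** Lebesgue measure is determined by its values on the intervals []a, b]], and translating such an
    interval keeps its length. *)
Lemma lebesgue_translation (g : R -> \bar R) (c : R) :
  measurable_fun setT g -> (forall x, 0 <= g x)%E ->
  (\int[leb]_t g (t + c)%R = \int[leb]_t g t)%E.
Proof.
move=> mg g0.
have mf : @measurable_fun _ _ (measurableTypeR R) (measurableTypeR R) setT (fun t : R => t + c).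
  by apply: measurable_funD => //; exact: measurable_cst.
rewrite -(integral_pushforward_measure leb mf) //.
apply: eq_measure_integral => /= A mA _; apply/esym/lebesgue_measure_unique => //=.
move=> _ [[a b]] _ <-; rewrite /pushforward.
rewrite (_ : _ @^-1` _ = [set` `]a - c, b - c]]); last first.
  by apply/seteqP; split=> x /=; rewrite !in_itv/= ltrBlDr lerBrDr.
by rewrite !lebesgue_measure_itv/= !lte_fin ltrD2r; case: ifP => // _; rewrite -!EFinD; congr EFin; ring.
Qed.

Variable n : nat.
Local Notation V := 'rV[R]_n.

Definition set_coord (k : nat) (w : V) (t : R) : V :=
  \row_i (if (i : nat) == k then t else w 0 i).

Lemma measurable_set_coord k : measurable_fun setT (fun p : measurableTypeR R * V => set_coord k p.2 p.1).
Proof.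
apply: measurable_fun_rV => i.
under eq_fun do rewrite mxE.
case: eqP => _; first exact: measurable_fst.
by apply: (measurableT_comp (measurable_coord i)); exact: measurable_snd.
Qed.

(** The measure built from the first [k] coordinates lives on the vectors whose other coordinates
    vanish, so only translations along that subspace can preserve it. *)
Definition proj_below k (c : V) : V := \row_i (if (i < k)%N then c 0 i else 0).

Lemma measurable_shift (c : V) : measurable_fun setT (fun x : V => x + c).
Proof.
apply: measurable_fun_rV => i; under eq_fun do rewrite mxE.
by apply: measurable_funD => //; exact: measurable_coord.
Qed.

Definition box k (a : R) : set V := [set x | forall i : 'I_n, (i < k)%N -> `|x 0 i| <= a].

Lemma measurable_box k a : measurable (box k a).
Proof.
rewrite (_ : box k a = \bigcap_(i in [set i : 'I_n | (i < k)%N]) [set t | `|t 0 i| <= a]);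
  last by apply/seteqP; split=> [t h i /= ik | t h i ik]; [exact: h|exact: (h i ik)].
apply: fin_bigcap_measurable => // i _.
have mf : measurable_fun setT (fun t : V => `|t 0 i|).
  by apply: measurableT_comp => //; exact: measurable_coord.
have := mf measurableT `]-oo, a]%classic (measurable_itv _); rewrite setTI.
by congr measurable; apply/seteqP; split=> t /=; rewrite in_itv.
Qed.

(** All stages live on the same space: starting from the Dirac mass at 0, each step pushes the
    product with one-dimensional Lebesgue measure forward along [set_coord]. The order of
    integration matches [iint]. The value on boxes yields sigma-finiteness, which the next product
    requires. *)
Lemma exists_lebesgue_row k : (k <= n)%N ->
  exists m : {sigma_finite_measure set V -> \bar R},
  [/\ forall F : V -> \bar R, measurable_fun setT F -> (forall x, 0 <= F x)%E ->
        (\int[m]_x F x = iint k (fun x => F (\row_(i < n) if (i < k)%N then x i else 0%R)))%E,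
      forall (c : V) (F : V -> \bar R), measurable_fun setT F -> (forall x, 0 <= F x)%E ->
        (\int[m]_x F (x + proj_below k c)%R = \int[m]_x F x)%E
    & forall a : R, 0 <= a -> m (box k a) = ((2 * a) ^+ k)%:E].
Proof.
elim: k => [_|k IH kn].
  exists (dirac (0 : V)); split => [F mF F0|c F mF F0|a a0].
  - by rewrite integral_dirac// diracT mul1e/=; congr F; apply/rowP => i; rewrite !mxE.
  - have mF' : measurable_fun setT (fun x : V => F (x + proj_below 0 c)).
      by apply: (measurableT_comp mF); exact: measurable_shift.
    rewrite !integral_dirac// diracT !mul1e; congr F.
    by apply/rowP => i; rewrite !mxE/= addr0.
  - by rewrite /= /dirac indicE mem_set.
have [m [mI mT mB]] := IH (ltnW kn).
pose m' := pushforward_measure (product_measure1 leb m) (measurable_set_coord k).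
have m'E (F : V -> \bar R) : measurable_fun setT F -> (forall x, 0 <= F x)%E ->
    (\int[m']_x F x = \int[leb]_t \int[m]_w F (set_coord k w t))%E.
  move=> mF F0; rewrite integral_pushforward_measure//; apply: (fubini_tonelli1 (m1:=leb) (m2:=m) (fun p => F (set_coord k p.2 p.1))) => //.
  exact: (measurableT_comp mF (measurable_set_coord k)).
have m'B a : 0 <= a -> m' (box k.+1 a) = ((2 * a) ^+ k.+1)%:E.
  move=> a0.
  rewrite /m' /pushforward_measure /= /pushforward.
  rewrite (_ : _ @^-1` _ = `[- a, a] `*` box k a); last first.
    apply/seteqP; split=> -[t w] /= => [h|[h1 h2] i].
      split=> [|i ik].
        have := h (Ordinal kn) (ltnSn k); rewrite mxE/= eqxx in_itv/=.
        by rewrite ler_norml.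
      by have := h i (ltnW ik); rewrite mxE/= ltn_eqF.
    rewrite mxE/= ltnS leq_eqVlt; case: eqVneq => [_ _|_ /=].
      by move: h1; rewrite in_itv/= ler_norml.
    exact: h2.
  rewrite product_measure1E//; last exact: measurable_box.
  rewrite mB//= lebesgue_measure_itv/= lte_fin.
  rewrite exprS EFinM; congr (_ * _)%E.
  case: ltP => [_|h]; first by rewrite -EFinD; congr EFin; ring.
  by congr EFin; lra.
have sf : sigma_finite setT m'.
  exists (fun j => box k.+1 j%:R).
    apply/esym/seteqP; split => // x _.
    pose a := \sum_(i < n) `|x 0 i|.
    exists (Num.truncn a).+1 => // i _.
    rewrite ltW// (le_lt_trans _ (truncnS_gt a))//.
    by rewrite /a (bigD1 i)//= lerDl sumr_ge0.
  move=> j; split; first exact: measurable_box.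
  by rewrite m'B ?ltry.
pose sfm := Measure_isSigmaFinite.Build _ _ _ m' sf.
pose M : {sigma_finite_measure set V -> \bar R} := HB.pack (Measure.sort m') (Measure.class m') sfm.
exists M; split => [F mF F0|c F mF F0|a a0]; last exact: m'B.
- rewrite [LHS]m'E//=; apply: eq_integral => t _.
  have mFt : measurable_fun setT (fun w => F (set_coord k w t)).
    apply: (measurableT_comp mF).
    exact: (measurableT_comp (measurable_set_coord k) (pair1_measurable t)).
  rewrite mI//; congr iint; apply/funext => x; congr F; apply/rowP => i; rewrite !mxE.
  by rewrite ltnS [(i <= k)%N]leq_eqVlt; case: (_ == k).
- have mFc : measurable_fun setT (fun x : V => F (x + proj_below k.+1 c)).
    by apply: (measurableT_comp mF); exact: measurable_shift.
  have updm t : measurable_fun setT (fun w => set_coord k w t).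
    exact: (measurableT_comp (measurable_set_coord k) (pair1_measurable t)).
  apply: (etrans (m'E _ mFc (fun x => F0 _))); apply: (etrans _ (esym (m'E _ mF F0))).
  pose c' := c 0 (Ordinal kn).
  (* The translation splits into [c'] in the new coordinate and [proj_below k c] in the others,
     which the induction hypothesis absorbs. *)
  transitivity (\int[leb]_t \int[m]_w F (set_coord k w (t + c')))%E.
    apply: eq_integral => t _.
    rewrite -(mT c (fun w => F (set_coord k w (t + c'))))//; last first.
      by apply: (measurableT_comp mF).
    apply: eq_integral => w _; congr F; apply/rowP => i; rewrite !mxE.
    rewrite ltnS [(i <= k)%N]leq_eqVlt; case: eqVneq => //= ik.
    by congr (_ + c _ _); exact: val_inj.
  apply: (lebesgue_translation c' (g := fun t => (\int[m]_w F (set_coord k w t))%E)).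
    apply: (measurable_fun_fubini_tonelli_F (fun p => F (set_coord k p.2 p.1))) => //.
    exact: (measurableT_comp mF (measurable_set_coord k)).
  by move=> t; exact: integral_ge0.
Qed.

End LebesgueRow.

(** * Euclidean inner product and norm of row vectors *)

Section DotProduct.
Variables (R : realType) (n : nat).
Local Notation V := 'rV[R]_n.
Implicit Types x y z : V.

Lemma dotvE x y : dotv x y = (x *m y^T) 0 0.
Proof. by rewrite mxE; apply: eq_bigr => i _; rewrite mxE. Qed.

Lemma dotvC x y : dotv x y = dotv y x.
Proof. by apply: eq_bigr => i _; rewrite mulrC. Qed.

Lemma dotvDl x y z : dotv (x + y) z = dotv x z + dotv y z.
Proof. by rewrite -big_split; apply: eq_bigr => i _; rewrite mxE mulrDl. Qed.

Lemma dotvZl a x y : dotv (a *: x) y = a * dotv x y.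
Proof. by rewrite /dotv mulr_sumr; apply: eq_bigr => i _; rewrite mxE mulrA. Qed.

Lemma dotvDr x y z : dotv z (x + y) = dotv z x + dotv z y.
Proof. by rewrite dotvC dotvDl !(dotvC z). Qed.

Lemma dotvZr a x y : dotv x (a *: y) = a * dotv x y.
Proof. by rewrite dotvC dotvZl dotvC. Qed.

Lemma dotvNl x y : dotv (- x) y = - dotv x y.
Proof. by rewrite -scaleN1r dotvZl mulN1r. Qed.

Lemma dotvNr x y : dotv x (- y) = - dotv x y.
Proof. by rewrite dotvC dotvNl dotvC. Qed.

Lemma dotv_ge0 x : 0 <= dotv x x.
Proof. by apply: sumr_ge0 => i _; rewrite -expr2 sqr_ge0. Qed.

Lemma dotv_eq0 x : dotv x x = 0 -> x = 0.
Proof.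
move=> /eqP; rewrite psumr_eq0 => [/allP h|i _]; last by rewrite -expr2 sqr_ge0.
apply/rowP => i; rewrite mxE; apply/eqP.
by have := h i (mem_index_enum _); rewrite -expr2 sqrf_eq0.
Qed.

Lemma enorm_ge0 x : 0 <= enorm x. Proof. exact: sqrtr_ge0. Qed.

Lemma enorm_sqr x : enorm x ^+ 2 = dotv x x.
Proof. by rewrite sqr_sqrtr// dotv_ge0. Qed.

Lemma enorm0 : enorm (0 : V) = 0.
Proof. by rewrite /enorm /dotv big1 ?sqrtr0// => i _; rewrite mxE mul0r. Qed.

Lemma enormN x : enorm (- x) = enorm x.
Proof. by rewrite /enorm dotvNl dotvNr opprK. Qed.

Lemma sphereP x : sphere n x <-> dotv x x = 1.
Proof.
rewrite /sphere /mkset -enorm_sqr; split => [->|/eqP]; first by rewrite expr1n.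
by rewrite sqrf_eq1 => /orP[/eqP//|/eqP h]; have := enorm_ge0 x; rewrite h oppr_ge0 ler10.
Qed.

Lemma dotv_mulmx (M : 'M[R]_n) x y : M *m M^T = 1%:M ->
  dotv (x *m M) (y *m M) = dotv x y.
Proof. by move=> MM; rewrite !dotvE trmx_mul mulmxA -(mulmxA x) MM mulmx1. Qed.

Lemma enorm_mulmx (M : 'M[R]_n) x : M *m M^T = 1%:M -> enorm (x *m M) = enorm x.
Proof. by move=> MM; rewrite /enorm dotv_mulmx. Qed.

Lemma measurable_fun_dotv d (T : measurableType d) (f g : T -> V) :
  measurable_fun setT f -> measurable_fun setT g ->
  measurable_fun setT (fun t => dotv (f t) (g t)).
Proof.
move=> mf mg; apply: measurable_sum => i.
by apply: measurable_funM; apply: (measurableT_comp (measurable_coord i)).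
Qed.

Lemma measurable_fun_enorm d (T : measurableType d) (f : T -> V) :
  measurable_fun setT f -> measurable_fun setT (fun t => enorm (f t)).
Proof.
move=> mf; have ms : measurable_fun setT (Num.sqrt : R -> R).
  by apply: continuous_measurable_fun; exact: sqrt_continuous.
exact: (measurableT_comp ms (measurable_fun_dotv mf mf)).
Qed.

Lemma measurable_fun_addv d (T : measurableType d) (f g : T -> V) :
  measurable_fun setT f -> measurable_fun setT g ->
  measurable_fun setT (fun t => f t + g t).
Proof.
move=> mf mg; apply: measurable_fun_rV => i; under eq_fun do rewrite mxE.
by apply: measurable_funD; apply: (measurableT_comp (measurable_coord i)).
Qed.

Lemma measurable_fun_scalev d (T : measurableType d) (a : T -> R) (f : T -> V) :
  measurable_fun setT a -> measurable_fun setT f ->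
  measurable_fun setT (fun t => a t *: f t).
Proof.
move=> ma mf; apply: measurable_fun_rV => i; under eq_fun do rewrite mxE.
by apply: measurable_funM => //; apply: (measurableT_comp (measurable_coord i)).
Qed.

Lemma measurable_fun_oppv d (T : measurableType d) (f : T -> V) :
  measurable_fun setT f -> measurable_fun setT (fun t => - f t).
Proof.
move=> mf; under eq_fun do rewrite -scaleN1r.
by apply: measurable_fun_scalev => //; exact: measurable_cst.
Qed.

Lemma measurable_fun_mulmx (M : 'M[R]_n) : measurable_fun setT (fun x : V => x *m M).
Proof.
apply: measurable_fun_rV => i; under eq_fun do rewrite mxE.
apply: measurable_sum => j.
by apply: measurable_funM; [exact: measurable_coord|exact: measurable_cst].
Qed.

Lemma measurable_uball : measurable (uball n : set V).
Proof.
have menid : measurable_fun setT (id : V -> V) by exact: measurable_id.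
have := measurable_fun_enorm menid measurableT (measurable_itv `]-oo, (1:R)[).
by rewrite setTI; congr measurable; apply/seteqP; split=> t /=; rewrite in_itv.
Qed.

Lemma measurable_sphere : measurable (sphere n : set V).
Proof.
have menid : measurable_fun setT (id : V -> V) by exact: measurable_id.
have := measurable_fun_enorm menid measurableT (measurable_set1 (1 : R)).
by rewrite setTI.
Qed.

End DotProduct.

(** * Invariance of Lebesgue measure under translations and orthogonal maps *)

Section LebesgueMeasure.
Variables (R : realType) (n : nat).
Local Notation V := 'rV[R]_n.

Definition lebesgue_row : {sigma_finite_measure set V -> \bar R} :=
  projT1 (cid (exists_lebesgue_row R (leqnn n))).

Lemma lebesgue_rowE (F : V -> \bar R) : measurable_fun setT F -> (forall x, 0 <= F x)%E ->
  (\int[lebesgue_row]_x F x = lebint F)%E.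
Proof.
rewrite /lebesgue_row; case: cid => m [mI _ _] mF F0 /=; rewrite mI//; congr iint.
apply/funext => x; congr F; apply/rowP => i; rewrite !mxE ltn_ord //.
Qed.

Lemma lebesgue_row_shift (c : V) (F : V -> \bar R) : measurable_fun setT F -> (forall x, 0 <= F x)%E ->
  (\int[lebesgue_row]_x F (x + c)%R = \int[lebesgue_row]_x F x)%E.
Proof.
rewrite /lebesgue_row; case: cid => m [_ mT _] mF F0 /=; rewrite -(mT c F)//; apply: eq_integral => x _.
by congr (F (_ + _)); apply/rowP => i; rewrite !mxE ltn_ord.
Qed.

Lemma lebesgue_row_box a : 0 <= a -> lebesgue_row (box n a) = ((2 * a) ^+ n)%:E.
Proof. by rewrite /lebesgue_row; case: cid => m [_ _ mB] a0 /=; rewrite mB. Qed.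

Lemma lebesgue_row_uball_lty : (lebesgue_row (uball n) < +oo)%E.
Proof.
rewrite (@le_lt_trans _ _ (lebesgue_row (box n 1)))//.
  apply: le_measure; rewrite ?inE; first exact: measurable_uball.
    exact: measurable_box.
  move=> x xB i _.
  have : x 0 i ^+ 2 <= 1.
    rewrite (@le_trans _ _ (dotv x x))//.
      by rewrite /dotv (bigD1 i)//= -expr2 lerDl sumr_ge0// => j _; rewrite -expr2 sqr_ge0.
    by rewrite -enorm_sqr expr_le1// ?enorm_ge0// ltW.
  by rewrite -[x 0 i ^+ 2]ger0_norm ?sqr_ge0// normrX expr_le1.
by rewrite lebesgue_row_box ?ltry.
Qed.

Lemma lebesgue_row_uball_gt0 : (0 < lebesgue_row (uball n))%E.
Proof.
(* The box lies in the open ball because [n * a ^+ 2 <= n * a < 1]. *)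
pose a : R := n.+1%:R^-1.
have a0 : 0 < a by rewrite invr_gt0.
rewrite (@lt_le_trans _ _ (lebesgue_row (box n a)))//.
  by rewrite lebesgue_row_box ?ltW// lte_fin exprn_gt0// mulr_gt0.
apply: le_measure; rewrite ?inE; last 2 first.
- exact: measurable_uball.
- move=> x xa; rewrite /uball/= /enorm -sqrtr1 ltr_sqrt//.
  apply: (@le_lt_trans _ _ (\sum_(i < n) a)).
    apply: ler_sum => i _.
    rewrite (le_trans (ler_norm _))// normrM (@le_trans _ _ (a * a))//.
      by rewrite ler_pM// xa.
    by rewrite ler_piMr ?(ltW a0)// invf_le1 ?ler1n ?ltr0n.
  by rewrite sumr_const card_ord -mulr_natl ltr_pdivrMr ?ltr0n// mul1r ltr_nat ltnSn.
exact: measurable_box.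
Qed.

(* Uniqueness of Haar measure: evaluate the double integral of
   [F x * 1_B (y M - x)] in the two possible orders. *)
Lemma lebesgue_row_mulmx (M : 'M[R]_n) (F : V -> \bar R) : M *m M^T = 1%:M ->
  measurable_fun setT F -> (forall x, 0 <= F x)%E ->
  (\int[lebesgue_row]_x F (x *m M)%R = \int[lebesgue_row]_x F x)%E.
Proof.
move=> MM mF F0.
have MM' : M^T *m M = 1%:M by exact: mulmx1C.
pose B z : \bar R := (\1_(uball n : set V) z)%:E.
have mB : measurable_fun setT B.
  by apply/measurable_EFinP; apply: measurable_indic; exact: measurable_uball.
have B0 z : (0 <= B z)%E by rewrite lee_fin.
have BM z : B (z *m M) = B z.
  rewrite /B; congr EFin; rewrite !indicE; congr (nat_of_bool _)%:R.
  by apply/idP/idP; rewrite !inE /uball/= enorm_mulmx.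
have BN z : B (- z) = B z.
  rewrite /B; congr EFin; rewrite !indicE; congr (nat_of_bool _)%:R.
  by apply/idP/idP; rewrite !inE /uball/= enormN.
have mM := @measurable_fun_mulmx R n M.
have mFM : measurable_fun setT (fun x : V => F (x *m M)) by exact: (measurableT_comp mF).
have IB : (\int[lebesgue_row]_x B x = lebesgue_row (uball n))%E.
  by rewrite integral_indic ?setIT//; exact: measurable_uball.
suff : ((\int[lebesgue_row]_x F x) * lebesgue_row (uball n) = (\int[lebesgue_row]_x F (x *m M)%R) * lebesgue_row (uball n))%E.
  have := lebesgue_row_uball_lty; have := lebesgue_row_uball_gt0.
  case: (lebesgue_row (uball n)) => // r r0 _.
  move=> h; apply/esym.
  have : forall u v : \bar R, (u * r%:E = v * r%:E -> u = v)%E.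
    move=> u v /(congr1 (fun z => z * (r^-1)%:E)%E).
    by rewrite -!muleA -!EFinM divff ?gt_eqF// !mule1.
  exact.
have mBS (f : V * V -> V) : measurable_fun setT f -> measurable_fun setT (B \o f).
  by move=> mf; exact: measurableT_comp.
have m1 : measurable_fun setT (fun p : V * V => (p.2 *m M) - p.1).
  apply: measurable_fun_addv; last by apply: measurable_fun_oppv.
  exact: (measurableT_comp mM).
have m2 : measurable_fun setT (fun p : V * V => p.1 + (p.2 *m M)).
  by apply: measurable_fun_addv => //; exact: (measurableT_comp mM).
rewrite -IB -ge0_integralZr//; last by apply: integral_ge0 => ? _.
transitivity (\int[lebesgue_row]_x \int[lebesgue_row]_y (F x * B (y *m M - x)%R))%E.
  apply: eq_integral => x _; rewrite ge0_integralZl//; last first.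
    exact: (measurableT_comp (mBS _ m1) (pair1_measurable x)).
  congr (_ * _)%E.
  (* The ball is invariant under [M], so [B (y *m M - x)] is [B] at a translate of [y], and the
     inner integral is the volume of the ball. *)
  apply: (etrans (esym (lebesgue_row_shift (- (x *m M^T)) mB B0))); apply: eq_integral => y _.
  by rewrite -BM mulmxDl mulNmx -mulmxA MM' mulmx1.
rewrite (sfinite_Fubini lebesgue_row lebesgue_row (fun p => F p.1 * B (p.2 *m M - p.1)%R)%E); last 2 first.
- by move=> p; exact: mule_ge0.
- by apply: emeasurable_funM; [exact: (measurableT_comp mF)|exact: mBS].
transitivity (\int[lebesgue_row]_y \int[lebesgue_row]_x (F (x + y *m M)%R * B x))%E.
  apply: eq_integral => y _ /=.
  rewrite -(lebesgue_row_shift (y *m M) (F := fun x => F x * B (y *m M - x)%R)%E); last 2 first.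
  - apply: emeasurable_funM => //.
    exact: (measurableT_comp (mBS _ m1) (pair2_measurable y)).
  - by move=> x; exact: mule_ge0.
  by apply: eq_integral => x _; rewrite opprD addrCA subrr addr0 BN.
rewrite -(sfinite_Fubini lebesgue_row lebesgue_row (fun p => F (p.1 + p.2 *m M)%R * B p.1)%E); last 2 first.
- by move=> p; exact: mule_ge0.
- by apply: emeasurable_funM; [exact: (measurableT_comp mF)|exact: mBS].
rewrite -ge0_integralZl//; last by apply: integral_ge0 => ? _.
apply: eq_integral => x _ /=.
rewrite ge0_integralZr//; last first.
  by apply: (measurableT_comp mF); exact: (measurableT_comp m2 (pair1_measurable x)).
congr (_ * _)%E.
rewrite -(lebesgue_row_shift (x *m M^T) (F := fun x => F (x *m M)))//.
by apply: eq_integral => y _; rewrite mulmxDl -mulmxA MM' mulmx1 addrC.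
Qed.

End LebesgueMeasure.

(** * Uniform probability on the sphere *)

Lemma integral_mrestr d (T : measurableType d) (R : realType)
  (m : {measure set T -> \bar R}) (D : set T) (mD : measurable D) (f : T -> \bar R) :
  measurable_fun setT f -> (forall x, 0 <= f x)%E ->
  (\int[mrestr m mD]_x f x = \int[m]_(x in D) f x)%E.
Proof.
move=> mf f0; have mD' : measurable (~` D) by exact: measurableC.
rewrite -(setvU D) ge0_integral_setU//; last 2 first.
- by rewrite setvU.
- by rewrite disj_set2E setICl.
rewrite null_set_integral//; last 2 first.
- exact: measurable_funTS.
- by rewrite /= /mrestr setICl measure0.
rewrite add0e; apply: eq_measure_integral => A mA AD.
by rewrite /= /mrestr setIidl.
Qed.

Section SphereMeasure.
Variables (R : realType).
Local Notation leb := (@lebesgue_measure R).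

(** Coordinate 0 is integrated innermost, so agreement off the hyperplane where it vanishes is
    almost-everywhere agreement in a one-dimensional integral, with all other coordinates fixed. *)
Lemma iint_eq_off0 k (F1 F2 : (nat -> R) -> \bar R) : (0 < k)%N ->
  (forall x, x 0%N <> 0 -> F1 x = F2 x) ->
  (forall x, measurable_fun setT (fun t => F1 (fun i => if i == 0%N then t else x i))) ->
  (forall x, measurable_fun setT (fun t => F2 (fun i => if i == 0%N then t else x i))) ->
  iint k F1 = iint k F2.
Proof.
elim: k F1 F2 => // -[_ F1 F2 _ F12 m1 m2 /=|k IH F1 F2 _ F12 m1 m2].
  apply: ae_eq_integral => //.
  - by have := m1 (fun=> 0); congr measurable_fun; apply/funext => t; congr F1; apply/funext => -[|].
  - by have := m2 (fun=> 0); congr measurable_fun; apply/funext => t; congr F2; apply/funext => -[|].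
  exists [set (0 : R)]; split; [by []|exact: lebesgue_measure_set1|].
  move=> t /= h; apply: contrapT => t0; apply: h => _; exact: F12.
apply: eq_integral => t _; apply: (IH (fun x => F1 (fun i => if i == k.+1 then t else x i))
  (fun x => F2 (fun i => if i == k.+1 then t else x i))) => // x; first by move=> x0; exact: F12.
  have := m1 (fun i => if i == k.+1 then t else x i); congr measurable_fun.
  by apply/funext => s; congr F1; apply/funext => -[|i].
have := m2 (fun i => if i == k.+1 then t else x i); congr measurable_fun.
by apply/funext => s; congr F2; apply/funext => -[|i].
Qed.

Variable n : nat.
Local Notation V := 'rV[R]_n.

(* [radial_proj 0 = 0] is not on the sphere, so [sphereE] reads its argument off the sphere
   at the origin; this value is irrelevant. *)
Lemma lebint_eq_off0 (F1 F2 : V -> \bar R) : (0 < n)%N ->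
  measurable_fun setT F1 -> measurable_fun setT F2 ->
  (forall x, x <> 0 -> F1 x = F2 x) -> lebint F1 = lebint F2.
Proof.
move=> n0 m1 m2 F12; apply: iint_eq_off0 => // x.
- move=> x0; apply: F12 => /rowP/(_ (Ordinal n0)); rewrite !mxE; exact: x0.
- apply: (measurableT_comp m1); apply: measurable_fun_rV => i.
  under eq_fun do rewrite mxE.
  by case: ((i : nat) == 0%N); [exact: measurable_id|exact: measurable_cst].
- apply: (measurableT_comp m2); apply: measurable_fun_rV => i.
  under eq_fun do rewrite mxE.
  by case: ((i : nat) == 0%N); [exact: measurable_id|exact: measurable_cst].
Qed.

Definition radial_proj (x : V) : V := (enorm x)^-1 *: x.

Lemma measurable_radial_proj : measurable_fun setT radial_proj.
Proof.
apply: measurable_fun_scalev => //.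
under eq_fun do rewrite -powR_inv1 ?enorm_ge0//.
apply: (measurableT_comp (measurable_powR _)).
exact: measurable_fun_enorm.
Qed.

Lemma radial_proj_sphere (x : V) : x <> 0 -> sphere n (radial_proj x).
Proof.
move=> x0; apply/sphereP; rewrite /radial_proj dotvZl dotvZr mulrA -enorm_sqr.
rewrite expr2 mulrACA mulVf ?mul1r//; apply/eqP => h; apply: x0.
by apply: dotv_eq0; rewrite -enorm_sqr h expr0n.
Qed.

Definition ballvol : R := fine (lebesgue_row R n (uball n)).

Lemma ballvolE : (ballvol%:E = lebesgue_row R n (uball n))%E.
Proof.
by rewrite fineK// ge0_fin_numE// lebesgue_row_uball_lty.
Qed.

Lemma ballvol_gt0 : 0 < ballvol.
Proof. by rewrite -lte_fin ballvolE lebesgue_row_uball_gt0. Qed.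

Let cvol : {nonneg R} := NngNum (ltW (etrans (invr_gt0 ballvol) ballvol_gt0)).

Definition sphere_measure : {measure set V -> \bar R} :=
  pushforward_measure (mscale cvol (mrestr (lebesgue_row R n) (@measurable_uball R n))) measurable_radial_proj.

Lemma sphere_measure_setT : sphere_measure setT = 1%E.
Proof.
rewrite /sphere_measure /pushforward_measure/= /pushforward preimage_setT /mscale/= /mrestr setTI -ballvolE -EFinM mulVf//.
by rewrite gt_eqF// ballvol_gt0.
Qed.

Definition sphere_prob : probability V R :=
  HB.pack (Measure.sort sphere_measure) (Measure.class sphere_measure)
    (Measure_isProbability.Build _ _ _ sphere_measure sphere_measure_setT).

Local Notation B := (fun x : V => \1_(uball n : set V) x : R).

Lemma integral_sphere_prob (F : V -> \bar R) : measurable_fun setT F -> (forall x, 0 <= F x)%E ->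
  (\int[sphere_prob]_x F x = lebint (fun x => (B x)%:E * F (radial_proj x)) * (ballvol^-1)%:E)%E.
Proof.
move=> mF F0.
have mFN : measurable_fun setT (F \o radial_proj) by exact: (measurableT_comp mF measurable_radial_proj).
have mB : measurable_fun setT B by apply: measurable_indic; exact: measurable_uball.
transitivity (\int[sphere_measure]_x F x)%E; first by [].
rewrite integral_pushforward_measure// (ge0_integral_mscale _ measurableT cvol)//= muleC; congr (_ * _)%E.
rewrite integral_mrestr// -lebesgue_rowE; last 2 first.
- by apply: emeasurable_funM => //; exact/measurable_EFinP.
- by move=> x; rewrite mule_ge0// lee_fin.
rewrite integral_mkcond; apply: eq_integral => x _.
by rewrite patchE indicE; case: ifP => _; rewrite ?mul1e ?mul0e.
Qed.

End SphereMeasure.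

Section SphereMeasureTheory.
Variables (R : realType) (n : nat).
Hypothesis n0 : (0 < n)%N.
Local Notation V := 'rV[R]_n.
Local Notation B := (fun x : V => \1_(uball n : set V) x : R).
Local Notation P := (sphere_prob R n).

(** The radial projection misses the sphere only at the origin, which the iterated integral does not
    see. *)
Lemma sphere_prob_sphereC : P (~` (sphere n)) = 0%E.
Proof.
have mS : measurable (~` (sphere n : set V)) by apply: measurableC; exact: measurable_sphere.
rewrite -(setIT (~` sphere n)) -integral_indic//.
have mI : measurable_fun setT (fun x : V => (\1_(~` (sphere n : set V)) x)%:E : \bar R).
  by apply/measurable_EFinP; exact: measurable_indic.
rewrite integral_sphere_prob//.
rewrite (@lebint_eq_off0 _ _ _ (fun=> 0%E))//.
- rewrite -lebesgue_rowE//.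
  by rewrite integral0 mul0e.
- apply: emeasurable_funM.
    by apply/measurable_EFinP/measurable_indic; exact: measurable_uball.
  exact: (measurableT_comp mI (@measurable_radial_proj R n)).
- move=> x x0; rewrite [X in (_ * X)%E](_ : _ = 0%E) ?mule0//.
  by congr EFin; rewrite indicE memNset// => /(_ (radial_proj_sphere x0)).
Qed.

Lemma sphereE_integral (g : V -> R) :
  measurable_fun setT (fun x => \1_(sphere n : set V) x * g x) ->
  (forall x, sphere n x -> 0 <= g x) ->
  sphereE g = (\int[P]_x (\1_(sphere n : set V) x * g x)%:E)%E.
Proof.
move=> mg g0; pose h x := \1_(sphere n : set V) x * g x; rewrite -/(h _).
have mB : measurable_fun setT B by apply: measurable_indic; exact: measurable_uball.
have mhN : measurable_fun setT (h \o @radial_proj R n).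
  exact: (measurableT_comp mg (@measurable_radial_proj R n)).
rewrite integral_sphere_prob//; last 2 first.
- exact/measurable_EFinP.
- move=> x; rewrite lee_fin indicE; case: (boolP (_ \in _)); rewrite ?mul0r// mul1r inE.
  exact: g0.
rewrite /sphereE; congr (_ * _)%E; last first.
  congr EFin; congr (_^-1); rewrite /ballvol; congr fine.
  rewrite -lebesgue_rowE; first by rewrite integral_indic ?setIT//; exact: measurable_uball.
    exact/measurable_EFinP.
  by move=> x; rewrite lee_fin.
have hE x : x <> 0 -> h (radial_proj x) = g (radial_proj x).
  by move=> x0; rewrite /h indicE mem_set ?mul1r//; exact: radial_proj_sphere.
apply: lebint_eq_off0 => //; last by move=> x x0; rewrite -[X in (_ * X)%E]/((h (radial_proj x))%:E) hE.
  have s0 : measurable [set (0 : V)].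
    have m0 : measurable_fun setT (fun x : V => dotv x x) by exact: measurable_fun_dotv.
    have := m0 measurableT _ (measurable_set1 (0 : R)); rewrite setTI.
    congr measurable; apply/seteqP; split => x /=; first exact: dotv_eq0.
    by move=> ->; rewrite -enorm_sqr enorm0 expr0n.
  (* Measurability of [g] is known on the sphere only. Away from the origin the integrand agrees
     with the one for [h]; its value at the origin is restored by the indicator of that point. *)
  rewrite (_ : (fun x => _) = (fun x => (B x * (h (radial_proj x) + \1_[set (0 : V)] x * (g (radial_proj 0) - h (radial_proj 0))))%:E)).
    apply/measurable_EFinP/measurable_funM => //; apply: measurable_funD => //.
    apply: measurable_funM; last exact: measurable_cst.
    exact: measurable_indic.
  apply/funext => x; congr EFin; congr (_ * _); rewrite -/(radial_proj x).
  have [->|/eqP x0] := eqVneq x 0; first by rewrite indicE mem_set// mul1r addrC subrK.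
  by rewrite indicE memNset// mul0r addr0 hE.
apply: emeasurable_funM; exact/measurable_EFinP.
Qed.

Lemma sphere_prob_mulmx (M : 'M[R]_n) (F : V -> \bar R) : M *m M^T = 1%:M ->
  measurable_fun setT F -> (forall x, 0 <= F x)%E ->
  (\int[P]_x F (x *m M)%R = \int[P]_x F x)%E.
Proof.
move=> MM mF F0.
have mM := measurable_fun_mulmx M.
have mFN : measurable_fun setT (F \o @radial_proj R n) by exact: (measurableT_comp mF (@measurable_radial_proj R n)).
have mB : measurable_fun setT B by apply: measurable_indic; exact: measurable_uball.
have mG : measurable_fun setT (fun x => (B x)%:E * F (radial_proj x))%E.
  by apply: emeasurable_funM => //; exact/measurable_EFinP.
have G0 x : (0 <= (B x)%:E * F (radial_proj x))%E by rewrite mule_ge0// lee_fin.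
rewrite !integral_sphere_prob//; last exact: (measurableT_comp mF mM).
congr (_ * _)%E; rewrite -(lebesgue_rowE mG)// -(lebesgue_row_mulmx MM mG)// lebesgue_rowE//.
- congr lebint; apply/funext => x; congr (_ * _)%E.
    congr EFin; rewrite !indicE; congr (nat_of_bool _)%:R.
    by apply/idP/idP; rewrite !inE /uball/= enorm_mulmx.
  by rewrite /radial_proj enorm_mulmx// scalemxAl.
- exact: (measurableT_comp mG mM).
Qed.

End SphereMeasureTheory.

(** * Bounded measurable functions and their means *)

(** A class closed under the algebraic operations and integrable for every probability, so that
    real-valued means can be computed with freely. The bound holds everywhere, not almost
    everywhere. *)
Definition bmeas d (T : measurableType d) (R : realType) (g : T -> R) : Prop :=
  measurable_fun setT g /\ exists M, forall x, `|g x| <= M.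

Section BoundedMeasurable.
Context d (T : measurableType d) (R : realType).
Implicit Types f g : T -> R.

Lemma bmeas_cst (c : R) : bmeas (fun _ : T => c).
Proof. by split; [exact: measurable_cst|exists `|c|]. Qed.

Lemma bmeasD f g : bmeas f -> bmeas g -> bmeas (fun x => f x + g x).
Proof.
move=> [mf [a fa]] [mg [b gb]]; split; first exact: measurable_funD.
by exists (a + b) => x; rewrite (le_trans (ler_normD _ _))// lerD.
Qed.

Lemma bmeasM f g : bmeas f -> bmeas g -> bmeas (fun x => f x * g x).
Proof.
move=> [mf [a fa]] [mg [b gb]]; split; first exact: measurable_funM.
by exists (a * b) => x; rewrite normrM ler_pM.
Qed.

Lemma bmeasZ (c : R) f : bmeas f -> bmeas (fun x => c * f x).
Proof. by move=> bf; apply: bmeasM => //; exact: bmeas_cst. Qed.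

Lemma bmeasN f : bmeas f -> bmeas (fun x => - f x).
Proof.
move=> [mf [a fa]]; split; first exact: measurableT_comp.
by exists a => x; rewrite normrN.
Qed.

Lemma bmeasB f g : bmeas f -> bmeas g -> bmeas (fun x => f x - g x).
Proof. by move=> bf bg; apply: bmeasD => //; exact: bmeasN. Qed.

Lemma bmeas_norm f : bmeas f -> bmeas (fun x => `|f x|).
Proof.
move=> [mf [a fa]]; split; first exact: measurableT_comp.
by exists a => x; rewrite normr_id.
Qed.

Lemma bmeas_indic (A : set T) : measurable A -> bmeas (\1_A : T -> R).
Proof.
move=> mA; split; first exact: measurable_indic.
by exists 1 => x; rewrite indicE; case: (_ \in _); rewrite ?normr1 ?normr0.
Qed.

Lemma bmeas_comp d' (T' : measurableType d') (h : T' -> T) f :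
  measurable_fun setT h -> bmeas f -> bmeas (fun t => f (h t)).
Proof. by move=> mh [mf [a fa]]; split; [exact: measurableT_comp|exists a]. Qed.

End BoundedMeasurable.

Section Expectation.
Context d (T : measurableType d) (R : realType) (P : probability T R).
Implicit Types f g : T -> R.

Lemma bmeas_integrable f : bmeas f -> P.-integrable setT (EFin \o f).
Proof.
move=> [mf [a fa]]; apply: measurable_bounded_integrable => //.
  by rewrite (le_lt_trans (probability_le1 _ _))// ltry.
exists a; split; first exact: num_real.
by move=> b ab x _; rewrite /= (le_trans (fa x))// ltW.
Qed.

Lemma mean_EFin f : bmeas f -> ((\int[P]_x f x)%:E = \int[P]_x (f x)%:E)%E.
Proof. by move=> bf; rewrite fineK//; apply: integrable_fin_num => //; exact: bmeas_integrable. Qed.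

Lemma meanD f g : bmeas f -> bmeas g ->
  \int[P]_x (f x + g x) = \int[P]_x f x + \int[P]_x g x.
Proof. by move=> bf bg; rewrite RintegralD//; exact: bmeas_integrable. Qed.

Lemma meanB f g : bmeas f -> bmeas g ->
  \int[P]_x (f x - g x) = \int[P]_x f x - \int[P]_x g x.
Proof. by move=> bf bg; rewrite RintegralB//; exact: bmeas_integrable. Qed.

Lemma meanZ (c : R) f : bmeas f -> \int[P]_x (c * f x) = c * \int[P]_x f x.
Proof. by move=> bf; rewrite RintegralZl//; exact: bmeas_integrable. Qed.

Lemma mean_cst (c : R) : \int[P]_x c = c.
Proof.
rewrite [LHS]Rintegral_cst; last by [].
by rewrite [X in fine X](_ : _ = 1%E) ?mulr1//; exact: probability_setT.
Qed.

Variable S : set T.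
Hypothesis mS : measurable S.
Hypothesis PS : P (~` S) = 0%E.

(** Multiplying [g - f] by the indicator of the full-measure set [S] keeps its mean. In the
    applications [S] is mostly the sphere, the only place where the kernel formulas hold. *)
Lemma mean_le f g : bmeas f -> bmeas g -> (forall x, S x -> f x <= g x) ->
  \int[P]_x f x <= \int[P]_x g x.
Proof.
move=> bf bg fg; rewrite -subr_ge0 -meanB//.
rewrite (_ : \int[P]_x _ = \int[P]_x (\1_S x * (g x - f x))).
  apply: Rintegral_ge0 => x _; rewrite indicE; case: (boolP (_ \in _)); rewrite ?mul0r// mul1r inE => Sx.
  by rewrite subr_ge0 fg.
congr fine; apply: ae_eq_integral => //.
- by apply/measurable_EFinP; case: (bmeasB bg bf).
- by apply/measurable_EFinP; case: (bmeasM (bmeas_indic R mS) (bmeasB bg bf)).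
- exists (~` S); split => //; first exact: measurableC.
  move=> x /= h Sx; apply: h => _.
  by rewrite indicE mem_set// mul1r.
Qed.

Lemma mean_eq f g : bmeas f -> bmeas g -> (forall x, S x -> f x = g x) ->
  \int[P]_x f x = \int[P]_x g x.
Proof.
by move=> bf bg fg; apply/le_anti/andP; split; apply: mean_le => // x Sx; rewrite fg.
Qed.

Lemma mean_ge0 f : bmeas f -> (forall x, S x -> 0 <= f x) -> 0 <= \int[P]_x f x.
Proof.
move=> bf f0; rewrite -[leLHS](mean_cst 0); apply: mean_le => //; exact: bmeas_cst.
Qed.

End Expectation.

Section ExpectationFubini.
Context d1 d2 (T1 : measurableType d1) (T2 : measurableType d2) (R : realType).
Variables (P1 : probability T1 R) (P2 : probability T2 R).
Implicit Types F : T1 * T2 -> R.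

Lemma bmeas_prod_integrable F : bmeas F -> (P1 \x P2)%E.-integrable setT (EFin \o F).
Proof.
move=> [mF [a Fa]]; apply: measurable_bounded_integrable => //.
  rewrite [X in (X < _)%E](_ : _ = 1%E) ?ltry// -setXTT.
  rewrite [LHS](product_measure1E P1 P2 measurableT measurableT).
  by rewrite [X in (X * _)%E](_ : _ = 1%E) ?mul1e; exact: probability_setT.
exists a; split; first exact: num_real.
by move=> b ab x _; rewrite /= (le_trans (Fa x))// ltW.
Qed.

Lemma bmeas_pair1 F x : bmeas F -> bmeas (fun y => F (x, y)).
Proof. by move=> bF; apply: (bmeas_comp (h := pair x)). Qed.

Lemma bmeas_pair2 F y : bmeas F -> bmeas (fun x => F (x, y)).
Proof. by move=> bF; apply: (bmeas_comp (h := fun x => (x, y))). Qed.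

Lemma bmeas_mean2 F : bmeas F -> bmeas (fun x => \int[P2]_y F (x, y)).
Proof.
move=> bF; split.
  apply/measurable_EFinP.
  rewrite (_ : _ \o _ = fubini_F P2 (EFin \o F)).
    exact: (measurable_fubini_F (bmeas_prod_integrable bF)).
  by apply/funext => x /=; rewrite mean_EFin//; exact: bmeas_pair1.
have [mF [a Fa]] := bF; exists a => x.
have bFx := bmeas_pair1 x bF.
rewrite (le_trans (le_normr_Rintegral _ _))//; first exact: bmeas_integrable.
rewrite -[leRHS](mean_cst P2 a); apply: (mean_le (S := setT)) => //.
- by rewrite setCT measure0.
- exact: bmeas_norm.
- exact: bmeas_cst.
Qed.

Lemma bmeas_mean1 F : bmeas F -> bmeas (fun y => \int[P1]_x F (x, y)).
Proof.
move=> bF; split.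
  apply/measurable_EFinP.
  rewrite (_ : _ \o _ = fubini_G P1 (EFin \o F)).
    exact: (measurable_fubini_G (bmeas_prod_integrable bF)).
  by apply/funext => x /=; rewrite mean_EFin//; exact: bmeas_pair2.
have [mF [a Fa]] := bF; exists a => x.
have bFx := bmeas_pair2 x bF.
rewrite (le_trans (le_normr_Rintegral _ _))//; first exact: bmeas_integrable.
rewrite -[leRHS](mean_cst P1 a); apply: (mean_le (S := setT)) => //.
- by rewrite setCT measure0.
- exact: bmeas_norm.
- exact: bmeas_cst.
Qed.

Lemma mean_Fubini F : bmeas F ->
  \int[P1]_x \int[P2]_y F (x, y) = \int[P2]_y \int[P1]_x F (x, y).
Proof.
move=> bF; apply: EFin_inj.
rewrite (mean_EFin _ (bmeas_mean2 bF)) (mean_EFin _ (bmeas_mean1 bF)).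
transitivity (\int[P1]_x \int[P2]_y (F (x, y))%:E)%E.
  by apply: eq_integral => x _; rewrite mean_EFin//; exact: bmeas_pair1.
rewrite (Fubini (bmeas_prod_integrable bF)).
by apply: eq_integral => y _; rewrite [RHS]mean_EFin//; exact: bmeas_pair2.
Qed.

End ExpectationFubini.

(** * Hyperplane reflections *)

Section Reflection.
Variables (R : realType) (n : nat).
Local Notation V := 'rV[R]_n.
Implicit Types u x y : V.

(** The Householder matrix of [u], acting on rows from the right; it is a reflection when [u] is a
    unit vector. *)
Definition refl_mx u : 'M[R]_n := 1%:M - 2 *: (u^T *m u).

Definition refl u x : V := x *m refl_mx u.

Lemma mulmx_tr_dotv x u : x *m u^T = (dotv x u)%:M.
Proof. by rewrite dotvE [LHS]mx11_scalar. Qed.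

Lemma reflE u x : refl u x = x - (2 * dotv x u) *: u.
Proof.
rewrite /refl /refl_mx mulmxBr mulmx1 -scalemxAr mulmxA mulmx_tr_dotv mul_scalar_mx.
by rewrite scalerA.
Qed.

Lemma reflK u x : dotv u u = 1 -> refl u (refl u x) = x.
Proof.
move=> uu; rewrite !reflE dotvDl dotvNl dotvZl uu mulr1 -addrA -opprD -scalerDl.
by rewrite [X in X *: _](_ : _ = 0) ?scale0r ?subr0//; ring.
Qed.

Lemma refl_mx_orth u : dotv u u = 1 -> refl_mx u *m (refl_mx u)^T = 1%:M.
Proof.
move=> uu.
have -> : (refl_mx u)^T = refl_mx u.
  by rewrite /refl_mx linearB/= linearZ/= trmx1 trmx_mul trmxK.
apply/row_matrixP => i; rewrite row_mul.
by have := reflK (row i (1%:M : 'M[R]_n)) uu; rewrite /refl -!row_mul !mul1mx.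
Qed.

Lemma measurable_refl u : measurable_fun setT (refl u).
Proof. exact: measurable_fun_mulmx. Qed.

Lemma dotv_refl u x y : dotv u u = 1 -> dotv (refl u x) (refl u y) = dotv x y.
Proof. by move=> uu; rewrite dotv_mulmx// refl_mx_orth. Qed.

Lemma dotv_refl_swap u x y : dotv u u = 1 -> dotv (refl u x) y = dotv x (refl u y).
Proof. by move=> uu; rewrite -{1}(reflK y uu) dotv_refl. Qed.

Lemma sphere_refl u x : dotv u u = 1 -> sphere n x -> sphere n (refl u x).
Proof. by move=> uu /sphereP xS; apply/sphereP; rewrite dotv_refl. Qed.

Lemma dotv_reflu u x : dotv u u = 1 -> dotv u (refl u x) = - dotv u x.
Proof. by move=> uu; rewrite reflE dotvDr dotvNr dotvZr uu (dotvC x); ring. Qed.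

Lemma sphere_dotv_le1 x y : sphere n x -> sphere n y -> `|dotv x y| <= 1.
Proof.
move=> /sphereP xx /sphereP yy; rewrite ler_norml.
have h1 := dotv_ge0 (x + y); have h2 := dotv_ge0 (x - y).
rewrite !dotvDl !dotvDr !dotvNl !dotvNr (dotvC y x) xx yy in h1 h2.
by apply/andP; split; lra.
Qed.

(** The normal is [x - y] scaled by the inverse of its norm. That norm is at most 2, whence
    [2^-1 <= k]; this later turns an error divided by [dotv u e] into one divided by the difference
    of the heights of [x] and [y]. *)
Lemma refl_exchange x y : sphere n x -> sphere n y -> x <> y ->
  exists u, [/\ dotv u u = 1, refl u x = y &
    exists k, [/\ 2^-1 <= k, u = k *: (x - y) & 0 < k]].
Proof.
move=> xS yS xy; pose w := x - y; have w0 : enorm w != 0.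
  apply/eqP => h; apply: xy; apply/eqP; rewrite -subr_eq0; apply/eqP/dotv_eq0.
  by rewrite -enorm_sqr h expr0n.
have e0 : 0 < enorm w by rewrite lt0r w0 enorm_ge0.
have/sphereP xx := xS; have /sphereP yy := yS.
have pole_inv_dist : enorm w ^+ 2 = 2 - 2 * dotv x y.
  by rewrite enorm_sqr /w !dotvDl !dotvDr !dotvNl !dotvNr (dotvC y x) xx yy; ring.
exists ((enorm w)^-1 *: w); split.
- by rewrite dotvZl dotvZr -enorm_sqr; field.
- rewrite reflE dotvZr scalerA.
  rewrite (_ : 2 * _ * _ = 1); first by rewrite scale1r /w opprB addrC subrK.
  rewrite (_ : _ * _ = 2 * dotv x w / enorm w ^+ 2); last by field.
  rewrite pole_inv_dist /w dotvDr dotvNr xx (_ : 2 * (1 - _) = 2 - 2 * dotv x y); last by ring.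
  by rewrite divff// -pole_inv_dist expf_neq0.
- exists (enorm w)^-1; split => //; last by rewrite invr_gt0.
  rewrite lef_pV2 ?posrE// leNgt; apply/negP => h.
  have : 4 < enorm w ^+ 2 by rewrite expr2; nra.
  by have := sphere_dotv_le1 xS yS; rewrite pole_inv_dist ler_norml => /andP[]; lra.
Qed.

End Reflection.

Section Clamp.
Variable R : realType.

(* Clamping inner products makes functions of them globally bounded, without
   changing them on the sphere. *)
Definition clamp (s : R) : R := Num.max (-1) (Num.min 1 s).

Lemma clamp_id s : `|s| <= 1 -> clamp s = s.
Proof.
by rewrite ler_norml => /andP[s1 s2]; rewrite /clamp (min_idPr s2) (max_idPr s1).
Qed.

Lemma clamp_le1 s : `|clamp s| <= 1.
Proof. by rewrite /clamp ler_norml le_max ge_max ge_min !lexx/= andbT; lra. Qed.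

Lemma measurable_clamp : measurable_fun setT clamp.
Proof.
apply: measurable_maxr; first exact: measurable_cst.
by apply: measurable_minr; [exact: measurable_cst|exact: measurable_id].
Qed.

End Clamp.

Section SphereExpectation.
Variables (R : realType) (n : nat).
Local Notation V := 'rV[R]_n.
Local Notation P := (sphere_prob R n).

Lemma bmeas_refl (u : V) (g : V -> R) : bmeas g -> bmeas (fun x => g (refl u x)).
Proof. by move=> bg; apply: bmeas_comp => //; exact: measurable_refl. Qed.

Lemma mean_refl (u : V) (g : V -> R) : dotv u u = 1 -> bmeas g ->
  \int[P]_x g (refl u x) = \int[P]_x g x.
Proof.
move=> uu bg; have [mg [a ga]] := bg.
(* Adding the bound [a] makes the function nonnegative, the case in which invariance is known. *)
have ba : bmeas (fun x => g x + a) by apply: bmeasD => //; exact: bmeas_cst.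
suff : \int[P]_x (g (refl u x) + a) = \int[P]_x (g x + a).
  rewrite !meanD//; [exact: addIr|exact: bmeas_cst|exact: bmeas_refl|exact: bmeas_cst].
apply: EFin_inj; rewrite !mean_EFin//; last exact: (bmeas_refl u ba).
apply: (sphere_prob_mulmx (refl_mx_orth uu) (F := fun x => (g x + a)%:E)).
  by apply/measurable_EFinP; case: ba.
move=> x; rewrite lee_fin; have := ga x; rewrite ler_norml => /andP[]; lra.
Qed.

End SphereExpectation.

(** * Mass of the Poisson kernel *)

Section FirstOrderExpansion.
Variables (R : realType) (I : Type) (ok : I -> R -> Prop).
Hypothesis ok_le1 : forall i h, ok i h -> `|h| <= 1.

(* [f i h = a i + b i * h + O(h^2)], uniformly in [i]. *)
Definition jet (f : I -> R -> R) (a b : I -> R) : Prop :=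
  exists C, forall i h, ok i h ->
    [/\ 0 <= C, `|a i| <= C, `|b i| <= C & `|f i h - a i - b i * h| <= C * h ^+ 2].

Lemma jet_ext f a b f' a' b' : jet f a b ->
  (forall i h, ok i h -> [/\ f i h = f' i h, a i = a' i & b i = b' i]) -> jet f' a' b'.
Proof.
by move=> [C fC] e; exists C => i h o; have [<- <- <-] := e _ _ o; exact: fC.
Qed.

Lemma jet_cst (c : I -> R) M : (forall i h, ok i h -> `|c i| <= M) ->
  jet (fun i _ => c i) c (fun _ => 0).
Proof.
move=> cM; exists M => i h o.
have M0 : 0 <= M by rewrite (le_trans _ (cM _ _ o)).
split; [by []|exact: (cM _ _ o)|by rewrite normr0|].
by rewrite mul0r subr0 subrr normr0 mulr_ge0 ?sqr_ge0.
Qed.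

Lemma jet_var : jet (fun _ h => h) (fun _ => 0) (fun _ => 1).
Proof.
by exists 1 => i h o; rewrite mul1r subr0 subrr normr0 normr1 mul1r sqr_ge0; split.
Qed.

Lemma jetD f a b g a' b' : jet f a b -> jet g a' b' ->
  jet (fun i h => f i h + g i h) (fun i => a i + a' i) (fun i => b i + b' i).
Proof.
move=> [C fC] [C' gC]; exists (C + C') => i h o.
have [C0 aC bC rC] := fC _ _ o; have [C0' aC' bC' rC'] := gC _ _ o.
split; first exact: addr_ge0.
- by rewrite (le_trans (ler_normD _ _))// lerD.
- by rewrite (le_trans (ler_normD _ _))// lerD.
- rewrite (_ : _ - _ = (f i h - a i - b i * h) + (g i h - a' i - b' i * h)); last by ring.
  by rewrite (le_trans (ler_normD _ _))// mulrDl lerD.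
Qed.

Lemma jetM f a b g a' b' : jet f a b -> jet g a' b' ->
  jet (fun i h => f i h * g i h) (fun i => a i * a' i) (fun i => a i * b' i + b i * a' i).
Proof.
(* Here 6 is 1 + 3 + 2: the product of the two linear terms, the remainder of [f] times
   [|g| <= 3 * C'], and the remainder of [g] times the linear part of [f], which is at most
   [2 * C]. *)
move=> [C fC] [C' gC]; exists (6 * (C * C')) => i h o.
have [C0 aC bC rC] := fC _ _ o; have [C0' aC' bC' rC'] := gC _ _ o.
have h1 := @ok_le1 _ _ o.
have CC0 : 0 <= C * C' by exact: mulr_ge0.
have hh : h ^+ 2 <= 1 by rewrite -[h ^+ 2]ger0_norm ?sqr_ge0// normrX expr_le1.
have aa : `|a i * a' i| <= C * C' by rewrite normrM ler_pM.
have ab : `|a i * b' i| <= C * C' by rewrite normrM ler_pM.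
have ba : `|b i * a' i| <= C * C' by rewrite normrM ler_pM.
have bb : `|b i * b' i| <= C * C' by rewrite normrM ler_pM.
split.
- by rewrite mulr_ge0.
- lra.
- by rewrite (le_trans (ler_normD _ _))//; lra.
have gb : `|g i h| <= 3 * C'.
  rewrite (_ : g i h = (g i h - a' i - b' i * h) + (a' i + b' i * h)); last by ring.
  rewrite (le_trans (ler_normD _ _))// (_ : 3 * C' = C' * 1 + (C' + C' * 1)); last by ring.
  rewrite lerD//; first by rewrite (le_trans rC')// ler_wpM2l.
  by rewrite (le_trans (ler_normD _ _))// lerD// normrM ler_pM.
have fb : `|a i + b i * h| <= 2 * C.
  rewrite (_ : 2 * C = C + C * 1); last by ring.
  by rewrite (le_trans (ler_normD _ _))// lerD// normrM ler_pM.
rewrite (_ : _ - _ = b i * b' i * h ^+ 2 + (f i h - a i - b i * h) * g i h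
  + (a i + b i * h) * (g i h - a' i - b' i * h)); last by ring.
rewrite (_ : 6 * _ * _ = C * C' * h ^+ 2 + C * h ^+ 2 * (3 * C') + 2 * C * (C' * h ^+ 2)); last by ring.
rewrite (le_trans (ler_normD _ _))// lerD//; last by rewrite normrM ler_pM.
rewrite (le_trans (ler_normD _ _))// lerD//; last by rewrite normrM ler_pM.
by rewrite normrM (ger0_norm (sqr_ge0 h)) ler_wpM2r// sqr_ge0.
Qed.

Lemma jetX f a b n : jet f a b ->
  jet (fun i h => f i h ^+ n) (fun i => a i ^+ n) (fun i => n%:R * a i ^+ n.-1 * b i).
Proof.
move=> jf; elim: n => [|n IH].
  apply: (jet_ext (@jet_cst (fun=> 1) 1 _)) => [i h _|i h o]; first by rewrite normr1.
  by rewrite !expr0 !mul0r; split.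
apply: (jet_ext (jetM jf IH)) => i h o; rewrite -!exprS; split => //.
case: n {IH} => [|n]/=; first by rewrite !expr0; ring.
by rewrite -[n.+2]addn1 natrD exprS; ring.
Qed.

(** With [x] and [z] as square roots, this is the expansion of the inverse square root at [x ^+ 2].
    The remainder has a closed form, [(z + 2 x) / (2 x^3 z (x + z)^2)] times the square of the
    increment, and [(z + 2 x) / 2 <= x + z]. *)
Lemma isqrt_expand (d x z : R) : 0 < d -> d <= x -> d <= z ->
  `|z^-1 - x^-1 + 2^-1 * x^-1 ^+ 3 * (z ^+ 2 - x ^+ 2)| <= d^-1 ^+ 5 * (z ^+ 2 - x ^+ 2) ^+ 2.
Proof.
move=> d0 dx dz; have x0 := lt_le_trans d0 dx; have z0 := lt_le_trans d0 dz.
have xz0 : 0 < x + z by rewrite addr_gt0.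
rewrite (_ : _ + _ = (x^-1 ^+ 3 * z^-1 * (x + z)^-1) * ((2^-1 * (z + 2 * x)) * (x + z)^-1) * (z ^+ 2 - x ^+ 2) ^+ 2);
  last by field; rewrite !gt_eqF.
rewrite normrM (ger0_norm (sqr_ge0 (_ - _))) ler_wpM2r ?sqr_ge0//.
rewrite ger0_norm; last by rewrite ?mulr_ge0 ?exprn_ge0 ?invr_ge0 ?ltW ?addr_gt0 ?mulr_gt0.
rewrite -[leRHS]mulr1 ler_pM//.
- by rewrite ?mulr_ge0 ?exprn_ge0 ?invr_ge0 ?ltW.
- by rewrite ?mulr_ge0 ?exprn_ge0 ?invr_ge0 ?ltW ?addr_gt0 ?mulr_gt0.
- have xd : x^-1 <= d^-1 by rewrite lef_pV2.
  have zd : z^-1 <= d^-1 by rewrite lef_pV2.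
  have xzd : (x + z)^-1 <= d^-1 by rewrite lef_pV2// (le_trans dx)// lerDl ltW.
  rewrite (_ : d^-1 ^+ 5 = d^-1 ^+ 3 * d^-1 * d^-1); last by ring.
  have x3 : x^-1 ^+ 3 <= d^-1 ^+ 3 by rewrite lerXn2r// nnegrE invr_ge0 ltW.
  have p1 : 0 <= x^-1 ^+ 3 by rewrite exprn_ge0// invr_ge0 ltW.
  have p2 : 0 <= z^-1 by rewrite invr_ge0 ltW.
  have p3 : 0 <= (x + z)^-1 by rewrite invr_ge0 ltW.
  by rewrite (ler_pM (mulr_ge0 p1 p2) p3)// (ler_pM p1 p2).
- by rewrite ler_pdivrMr//; lra.
Qed.

Lemma jet_isqrt f a b d : 0 < d -> jet f a b ->
  (forall i h, ok i h -> d ^+ 2 <= f i h /\ d ^+ 2 <= a i) ->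
  jet (fun i h => (Num.sqrt (f i h))^-1) (fun i => (Num.sqrt (a i))^-1)
      (fun i => - 2^-1 * (Num.sqrt (a i))^-1 ^+ 3 * b i).
Proof.
move=> d0 [C fC] fd.
(* The summands bound in turn the value, the slope together with the remainder of [f] passed through
   it, and the quadratic error of [isqrt_expand], in which [f - a] is at most [2 * C * |h|]. *)
exists (d^-1 + d^-1 ^+ 3 * C + d^-1 ^+ 5 * (4 * C ^+ 2)) => i h o.
have [C0 aC bC rC] := fC _ _ o; have [df da] := fd _ _ o.
have h1 := @ok_le1 _ _ o.
have d1 : 0 <= d^-1 by rewrite invr_ge0 ltW.
have sq u : d ^+ 2 <= u -> d <= Num.sqrt u.
  by move=> du; rewrite -(ger0_norm (ltW d0)) -sqrtr_sqr ler_wsqrtr.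
set x := Num.sqrt (a i); set z := Num.sqrt (f i h).
have dx : d <= x by exact: sq.
have dz : d <= z by exact: sq.
have xx : x ^+ 2 = a i by rewrite sqr_sqrtr// (le_trans _ da)// sqr_ge0.
have zz : z ^+ 2 = f i h by rewrite sqr_sqrtr// (le_trans _ df)// sqr_ge0.
have x0 := lt_le_trans d0 dx.
have xd : `|x^-1| <= d^-1 by rewrite ger0_norm ?invr_ge0 ?(ltW x0)// lef_pV2.
have xd3 : `|x^-1 ^+ 3| <= d^-1 ^+ 3 by rewrite normrX lerXn2r// nnegrE.
have half : `|2^-1 : R| <= 1 by rewrite ger0_norm; lra.
have t1 : 0 <= d^-1 ^+ 3 * C by rewrite mulr_ge0 ?exprn_ge0.
have t2 : 0 <= d^-1 ^+ 5 * (4 * C ^+ 2) by rewrite !mulr_ge0 ?exprn_ge0.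
have gb : forall v, `|v| <= C * 1 -> `|2^-1 * x^-1 ^+ 3 * v| <= d^-1 ^+ 3 * C.
  move=> v vC; rewrite normrM ler_pM//; last by rewrite mulr1 in vC.
  by rewrite normrM -[leRHS]mul1r ler_pM.
split.
- by rewrite !addr_ge0.
- lra.
- rewrite !mulNr normrN; have : `|b i| <= C * 1 by rewrite mulr1.
  by move/gb; lra.
have := isqrt_expand d0 dx dz; rewrite xx zz => ex.
have fa : (f i h - a i) ^+ 2 <= 4 * C ^+ 2 * h ^+ 2.
  rewrite -[X in X <= _]ger0_norm ?sqr_ge0// normrX.
  rewrite (_ : 4 * _ * _ = (2 * C * `|h|) ^+ 2); last first.
    by rewrite -[in LHS](real_normK (num_real h)); ring.
  rewrite lerXn2r ?nnegrE// ?mulr_ge0//.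
  rewrite (_ : _ - _ = (f i h - a i - b i * h) + b i * h); last by ring.
  rewrite (le_trans (ler_normD _ _))// (_ : 2 * C * _ = C * `|h| + C * `|h|); last by ring.
  rewrite lerD//; last by rewrite normrM ler_wpM2r.
  rewrite (le_trans rC)// ler_wpM2l// -(real_normK (num_real h)) expr2.
  by rewrite ler_piMl.
rewrite (_ : _ - _ = (z^-1 - x^-1 + 2^-1 * x^-1 ^+ 3 * (f i h - a i))
  - 2^-1 * x^-1 ^+ 3 * (f i h - a i - b i * h)); last by ring.
rewrite (le_trans (ler_normB _ _))//.
have e1 : `|z^-1 - x^-1 + 2^-1 * x^-1 ^+ 3 * (f i h - a i)| <= d^-1 ^+ 5 * (4 * C ^+ 2) * h ^+ 2.
  by rewrite (le_trans ex)// -mulrA ler_wpM2l// exprn_ge0.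
have e2 : `|2^-1 * x^-1 ^+ 3 * (f i h - a i - b i * h)| <= d^-1 ^+ 3 * C * h ^+ 2.
  rewrite -mulrA -[leRHS]mulrA -[leRHS]mul1r normrM ler_pM//.
  by rewrite normrM ler_pM.
have e3 : 0 <= d^-1 * h ^+ 2 by rewrite mulr_ge0 ?sqr_ge0.
by rewrite !mulrDl; lra.
Qed.

End FirstOrderExpansion.

(** * Elementary estimates and the inverse distance *)

Section Elementary.
Variable R : realType.

Lemma normr_le_bounds (a b x : R) : a <= x -> x <= b -> `|x| <= `|a| + `|b|.
Proof.
move=> ax xb; have := ler_norm b; have := ler_norm (- a); rewrite normrN.
have := normr_ge0 a; have := normr_ge0 b.
by move=> *; rewrite ler_norml; apply/andP; split; lra.
Qed.

Lemma shrunk_itv01 (c s : R) : 0 < c -> c <= s <= 1 - c -> 0 < s < 1.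
Proof. by move=> c0 /andP[h1 h2]; apply/andP; split; lra. Qed.

Lemma ler_sub_chain (x y z s b : R) : x <= y -> y + s <= z -> - b <= s -> x - z <= b.
Proof. by move=> *; lra. Qed.

Lemma le_eps_eq0 (x C : R) : (forall h, 0 < h -> h <= 1 -> `|x| <= C * h) -> x = 0.
Proof.
move=> H; apply/eqP; rewrite -normr_le0; apply/ler_addgt0Pl => e e0; rewrite addr0.
have C0 : 0 <= C by rewrite (le_trans (normr_ge0 x))// -[C]mulr1 H.
pose h := Num.min 1 (e / (C + 1)).
have h0 : 0 < h by rewrite lt_min ltr01 divr_gt0//; lra.
have h1 : h <= 1 by rewrite ge_min lexx.
rewrite (le_trans (H _ h0 h1))// (@le_trans _ _ (C * (e / (C + 1))))//.
  by rewrite ler_wpM2l// ge_min lexx orbT.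
by rewrite mulrA ler_pdivrMr; nra.
Qed.

(** Subtracting the estimates at [h] and [h / 2] eliminates [A] and leaves [|B| <= 3 * C * h]. *)
Lemma small_linear_eq0 (A B C : R) :
  (forall h, 0 < h -> h <= 1 -> `|A - B * h| <= C * h ^+ 2) -> B = 0.
Proof.
move=> H; apply: (@le_eps_eq0 _ (3 * C)) => h h0 h1.
have a1 := H h h0 h1.
have := H (h / 2); rewrite divr_gt0// => /(_ isT) a2.
have {}a2 : `|A - B * (h / 2)| <= C * (h / 2) ^+ 2 by apply: a2; lra.
have : `|B * (h / 2)| <= C * h ^+ 2 + C * (h / 2) ^+ 2.
  rewrite (_ : B * (h / 2) = (A - B * (h / 2)) - (A - B * h)); last by field.
  by rewrite (le_trans (ler_normB _ _))// addrC lerD.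
rewrite normrM (ger0_norm (_ : 0 <= h / 2)); last by lra.
have C0 : 0 <= C.
  by have := le_trans (normr_ge0 _) (H 1 ltr01 (lexx _)); rewrite expr1n mulr1.
rewrite !expr2 => h3; rewrite -(ler_pM2r h0).
have : 0 <= C * (h * h) by rewrite mulr_ge0// mulr_ge0// ltW.
by lra.
Qed.

(** [N] equal steps cost at most [C * (b / N) ^+ 2] each, hence at most [C / N] altogether. This is
    constancy from a vanishing derivative, with steps to the right only. *)
Lemma quadratic_const (f : R -> R) (b C : R) : 0 <= b ->
  (forall r h, 0 <= r -> 0 <= h -> h <= 1 -> r + h <= b -> `|f (r + h) - f r| <= C * h ^+ 2) ->
  b <= 1 -> f b = f 0.
Proof.
move=> b0 H b1; apply/eqP; rewrite -subr_eq0; apply/eqP.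
have [->|b0'] := eqVneq b 0; first by rewrite subrr.
have bgt0 : 0 < b by rewrite lt_neqAle eq_sym b0'.
have C0 : 0 <= C.
  have := le_trans (normr_ge0 _) (H 0 b (lexx _) b0 b1 _); rewrite add0r lexx => /(_ isT).
  by rewrite pmulr_lge0// exprn_gt0.
have step (N : nat) : (0 < N)%N -> `|f b - f 0| <= C * N%:R^-1.
  move=> N0; pose h := b / N%:R.
  have N0' : 0 < N%:R :> R by rewrite ltr0n.
  have h0 : 0 <= h by rewrite divr_ge0// ltW.
  have h1 : h <= N%:R^-1 by rewrite ler_piMl// invr_ge0 ltW.
  have k k' : (k' <= N)%N -> `|f (k'%:R * h) - f 0| <= k'%:R * (C * h ^+ 2).
    move=> kN; elim: k' kN => [|k' IH] kN; first by rewrite !mul0r subrr normr0.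
    rewrite (_ : f _ - f 0 = (f (k'%:R * h + h) - f (k'%:R * h)) + (f (k'%:R * h) - f 0)); last first.
      by rewrite -[k'.+1]addn1 natrD mulrDl mul1r; ring.
    rewrite (le_trans (ler_normD _ _))// -[k'.+1]addn1 natrD mulrDl mul1r addrC lerD ?IH 1?ltnW//.
    apply: H => //.
    - by rewrite mulr_ge0.
    - by rewrite (le_trans h1)// invf_le1// ler1n.
    - rewrite (_ : _ + h = k'.+1%:R * h); last by rewrite -[k'.+1]addn1 natrD; ring.
      rewrite (@le_trans _ _ (N%:R * h))//; first by rewrite ler_wpM2r// ler_nat.
      by rewrite /h mulrC divfK// gt_eqF.
  have := k N (leqnn _).
  have Nh : N%:R * h = b by rewrite /h mulrC divfK// gt_eqF.
  rewrite Nh => /le_trans; apply.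
  by rewrite mulrCA ler_wpM2l// expr2 mulrA Nh -[leRHS]mul1r ler_pM.
apply: (@le_eps_eq0 _ C) => h h0 h1.
have := step (Num.truncn h^-1).+1 (ltn0Sn _) => /le_trans; apply.
rewrite ler_wpM2l// -[leRHS]invrK lef_pV2 ?posrE ?invr_gt0 ?ltr0n//.
exact/ltW/truncnS_gt.
Qed.

Lemma measurable_invr_ge0 d (T : measurableType d) (f : T -> R) :
  measurable_fun setT f -> (forall x, 0 <= f x) -> measurable_fun setT (fun x => (f x)^-1).
Proof.
move=> mf f0; under eq_fun do rewrite -powR_inv1//.
exact: (measurableT_comp (measurable_powR _)).
Qed.

(** The squared distance from [x] to [r y] for unit vectors [x] and [y] with inner product [s]. *)
Definition dist2 (r s : R) : R := 1 + r ^+ 2 - 2 * r * s.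
Definition inv_dist (r s : R) : R := (Num.sqrt (dist2 r s))^-1.

Lemma dist2_ge (r0 r s : R) : 0 <= r -> r <= r0 -> r0 < 1 -> `|s| <= 1 ->
  (1 - r0) ^+ 2 <= dist2 r s.
Proof.
move=> r00 r01 r1; rewrite ler_norml => /andP[s1 s2].
rewrite (@le_trans _ _ ((1 - r) ^+ 2))//.
  by rewrite lerXn2r ?nnegrE; lra.
by rewrite /dist2 !expr2; nra.
Qed.

Lemma inv_dist_sqr (r s : R) : 0 <= r -> r < 1 -> `|s| <= 1 -> dist2 r s * inv_dist r s ^+ 2 = 1.
Proof.
move=> r0 r1 s1; have := dist2_ge r0 (lexx r) r1 s1 => q.
have q0 : 0 < dist2 r s by rewrite (lt_le_trans _ q)// exprn_gt0; lra.
by rewrite /inv_dist exprVn sqr_sqrtr ?divff ?gt_eqF// ltW.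
Qed.

Lemma inv_dist_bound (r s : R) : 0 <= r -> r < 1 -> `|s| <= 1 -> 0 <= inv_dist r s <= (1 - r)^-1.
Proof.
move=> r0 r1 s1; have q := dist2_ge r0 (lexx r) r1 s1.
have r1' : 0 < 1 - r by lra.
rewrite /inv_dist invr_ge0 sqrtr_ge0/=.
have : 1 - r <= Num.sqrt (dist2 r s).
  by rewrite -(ger0_norm (ltW r1')) -sqrtr_sqr ler_wsqrtr.
by move=> h; rewrite lef_pV2// posrE (lt_le_trans _ h).
Qed.

Lemma bmeas_inv_dist d (T : measurableType d) (r : R) (f : T -> R) : 0 <= r -> r < 1 ->
  measurable_fun setT f -> (forall x, `|f x| <= 1) -> bmeas (fun x => inv_dist r (f x)).
Proof.
move=> r0 r1 mf f1; split.
  apply: measurable_invr_ge0; last by move=> x; exact: sqrtr_ge0.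
  have ms : measurable_fun setT (Num.sqrt : R -> R).
    by apply: continuous_measurable_fun; exact: sqrt_continuous.
  apply: (measurableT_comp ms); apply: measurable_funB; first exact: measurable_cst.
  by apply: measurable_funM => //; exact: measurable_cst.
exists (1 - r)^-1 => x; have /andP[h0 h1] := inv_dist_bound r0 r1 (f1 x).
by rewrite ger0_norm.
Qed.

End Elementary.

Lemma bmeasX d (T : measurableType d) (R : realType) (f : T -> R) k :
  bmeas f -> bmeas (fun x => f x ^+ k).
Proof.
move=> bf; elim: k => [|k IH]; first by under eq_fun do rewrite expr0; exact: bmeas_cst.
by under eq_fun do rewrite exprS; exact: bmeasM.
Qed.

(** * Integration by parts on the sphere and Newton's theorem *)

Section PoissonMass.
Variables (R : realType) (m : nat).
Local Notation n := m.+2.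
Local Notation V := 'rV[R]_n.
Local Notation P := (sphere_prob R n).

Let mS : measurable (sphere n : set V) := @measurable_sphere R n.
Let PS : P (~` (sphere n)) = 0%E := sphere_prob_sphereC R (ltn0Sn _).

(** The constant of the remainder does not depend on the point of the sphere, so the expansion can
    be integrated term by term. This takes the place of differentiation under the integral sign. *)
Lemma mean_jet (J : Type) (okJ : J -> R -> Prop) (F : J -> R -> V -> R) (a b : J -> V -> R) :
  (forall j h, okJ j h -> bmeas (F j h)) ->
  (forall j h, okJ j h -> bmeas (a j)) -> (forall j h, okJ j h -> bmeas (b j)) ->
  jet (fun (i : J * V) h => okJ i.1 h /\ sphere n i.2) (fun i h => F i.1 h i.2)
    (fun i => a i.1 i.2) (fun i => b i.1 i.2) ->
  exists C, forall j h, okJ j h ->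
    `|\int[P]_y F j h y - \int[P]_y a j y - \int[P]_y b j y * h| <= C * h ^+ 2.
Proof.
move=> bF ba bb [C H]; exists C => j h o.
have bFj := bF _ _ o; have baj := ba _ _ o; have bbj := bb _ _ o.
have bhj : bmeas (fun y => h * b j y) by exact: bmeasZ.
rewrite (mulrC _ h) -meanZ// -meanB// -meanB//; last exact: bmeasB.
have bt : bmeas (fun y => F j h y - a j y - h * b j y) by apply: bmeasB => //; exact: bmeasB.
rewrite ler_norml; apply/andP; split.
- rewrite -[leLHS](mean_cst P); apply: (mean_le mS PS) => //; first exact: bmeas_cst.
  move=> y yS; have [_ _ _] := H (j, y) h (conj o yS).
  by rewrite /= (mulrC (b j y)) ler_norml => /andP[].
- rewrite -[leRHS](mean_cst P); apply: (mean_le mS PS) => //; first exact: bmeas_cst.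
  move=> y yS; have [_ _ _] := H (j, y) h (conj o yS).
  by rewrite /= (mulrC (b j y)) ler_norml => /andP[].
Qed.

Lemma sphere_coord_le1 (y : V) j : sphere n y -> `|y 0 j| <= 1.
Proof.
move=> yS; have e : dotv (delta_mx 0 j : V) y = y 0 j.
  rewrite /dotv (bigD1 j)//= big1 ?addr0 => [|i ij]; rewrite mxE eqxx/=.
    by rewrite eqxx mul1r.
  by rewrite (negPf ij) mul0r.
rewrite -e; apply: sphere_dotv_le1 => //; apply/sphereP.
rewrite /dotv (bigD1 j)//= big1 ?addr0 => [|i ij]; rewrite !mxE eqxx/=.
  by rewrite eqxx mul1r.
by rewrite (negPf ij) mul0r.
Qed.

Definition ccoord (j : 'I_n) (y : V) : R := clamp (y 0 j).

Lemma ccoordE j y : sphere n y -> ccoord j y = y 0 j.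
Proof. by move=> yS; rewrite /ccoord clamp_id// sphere_coord_le1. Qed.

Lemma measurable_ccoord j : measurable_fun setT (ccoord j).
Proof. exact: (measurableT_comp (@measurable_clamp R) (@measurable_coord R n j)). Qed.

Lemma bmeas_ccoord j : bmeas (ccoord j).
Proof. by split; [exact: measurable_ccoord|exists 1 => y; exact: clamp_le1]. Qed.

(** The pole is the basis vector of index [ord0]; on the sphere this is the inverse distance from
    [y] to the point at radius [r] on the axis. *)
Definition pole_inv_dist (r : R) (y : V) : R := inv_dist r (ccoord ord0 y).

Lemma bmeas_pole_inv_dist r : 0 <= r -> r < 1 -> bmeas (pole_inv_dist r).
Proof.
move=> r0 r1; apply: bmeas_inv_dist => //; first exact: measurable_ccoord.
by move=> y; exact: clamp_le1.
Qed.

(** The cosine belonging to the sine [h]. A number [c] in [0, 1] satisfies [1 - c <= 1 - c ^+ 2],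
    and here the right side is [h ^+ 2]. *)
Lemma jet_pythagoras (I : Type) (ok : I -> R -> Prop) :
  (forall i h, ok i h -> `|h| <= 1) ->
  jet ok (fun _ h => Num.sqrt (1 - h ^+ 2)) (fun _ => 1) (fun _ => 0).
Proof.
move=> ok1; exists 1 => i h o; rewrite normr1 normr0 mul0r subr0 mul1r; split => //.
have h1 : h ^+ 2 <= 1 by rewrite -[h ^+ 2]ger0_norm ?sqr_ge0// normrX expr_le1// (ok1 _ _ o).
have h0 := sqr_ge0 h.
set c := Num.sqrt _; have cE : c ^+ 2 = 1 - h ^+ 2 by rewrite sqr_sqrtr; lra.
have c0 : 0 <= c by exact: sqrtr_ge0.
have c1 : c <= 1 by move: cE; rewrite expr2; nra.
have c2 : c ^+ 2 <= c by rewrite expr2; nra.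
by rewrite ler_norml; apply/andP; split; lra.
Qed.

(* Compare the reflections in [cos t e_j + sin t e_0] as [t -> 0]. *)
Lemma mean_rotation (r : R) (j : 'I_n) : 0 <= r -> r < 1 -> j != ord0 ->
  \int[P]_y (ccoord ord0 y * pole_inv_dist r y ^+ m.+2
             - m.+2%:R * r * (ccoord j y ^+ 2 * pole_inv_dist r y ^+ m.+4)) = 0.
Proof.
move=> r0 r1 j0.
pose b y : R := ccoord ord0 y * pole_inv_dist r y ^+ m.+2 - m.+2%:R * r * (ccoord j y ^+ 2 * pole_inv_dist r y ^+ m.+4).
(* On the sphere [g] is odd in coordinate [j], so the reflection at [h = 0] turns it into [- g]; the
   first-order coefficient in [h] is [- 2 * b]. The mean of the reflected function is the same for
   all [h], which forces the mean of [b] to vanish. *)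
pose g y : R := ccoord j y * pole_inv_dist r y ^+ m.+2.
have bw := bmeas_pole_inv_dist r0 r1.
have bg : bmeas g by apply: bmeasM; [exact: bmeas_ccoord|exact: bmeasX].
have bb : bmeas b.
  apply: bmeasB; first by apply: bmeasM; [exact: bmeas_ccoord|exact: bmeasX].
  by apply: bmeasZ; apply: bmeasM; apply: bmeasX => //; exact: bmeas_ccoord.
pose u (h : R) : V := Num.sqrt (1 - h ^+ 2) *: delta_mx 0 j + h *: delta_mx 0 ord0.
have dot1 (k : 'I_n) (y : V) : dotv y (delta_mx 0 k) = y 0 k.
  rewrite /dotv (bigD1 k)//= big1 ?addr0 => [|i ij]; rewrite mxE eqxx/=.
    by rewrite eqxx mulr1.
  by rewrite (negPf ij) mulr0.
have yu h y : dotv y (u h) = Num.sqrt (1 - h ^+ 2) * y 0 j + h * y 0 ord0.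
  by rewrite dotvDr !dotvZr !dot1.
have u0 h : u h 0 ord0 = h.
  by rewrite !mxE !eqxx /= eq_sym (negPf j0) mulr0 add0r mulr1.
have uj h : u h 0 j = Num.sqrt (1 - h ^+ 2).
  by rewrite !mxE !eqxx /= (negPf j0) mulr0 addr0 mulr1.
pose okJ (_ : unit) (h : R) := 0 < h /\ h <= 1.
have uu h : 0 < h -> h <= 1 -> dotv (u h) (u h) = 1.
  move=> h0 h1; rewrite yu u0 uj -expr2 sqr_sqrtr; first by ring.
  by rewrite subr_ge0 expr_le1// ltW.
pose ok := fun (i : unit * V) h => okJ i.1 h /\ sphere n i.2.
have ok1 i h : ok i h -> `|h| <= 1 by case=> -[h0 h1] _; rewrite ger0_norm// ltW.
have jc := jet_pythagoras ok1.
have jh := @jet_var _ _ ok.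
have jcst (k : 'I_n) : jet ok (fun i _ => ccoord k i.2) (fun i => ccoord k i.2) (fun=> 0).
  by apply: (@jet_cst _ _ _ _ 1) => i h _; exact: clamp_le1.
have jk (k : R) : jet ok (fun _ _ => k) (fun=> k) (fun=> 0).
  by apply: (@jet_cst _ _ _ _ `|k|).
have jp := jetD (jetM ok1 jc (jcst j)) (jetM ok1 jh (jcst ord0)).
have jY := jetD (jcst j) (jetM ok1 (jk (- 2)) (jetM ok1 jp jc)).
have jX := jetD (jcst ord0) (jetM ok1 (jk (- 2)) (jetM ok1 jp jh)).
have jQ := jetD (jk (1 + r ^+ 2)) (jetM ok1 (jk (- (2 * r))) jX).
have ent (x v : V) (k : R) i : (x - k *: v) 0 i = x 0 i - k * v 0 i by rewrite !mxE.
have rfl0 h y : (refl (u h) y) 0 ord0 = y 0 ord0 - 2 * dotv y (u h) * h.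
  by rewrite reflE ent u0.
have rflj h y : (refl (u h) y) 0 j = y 0 j - 2 * dotv y (u h) * Num.sqrt (1 - h ^+ 2).
  by rewrite reflE ent uj.
have d0 : 0 < 1 - r by lra.
have jW := jet_isqrt ok1 d0 jQ.
have jF : jet ok (fun i h => g (refl (u h) i.2)) (fun i => - g i.2) (fun i => - 2 * b i.2).
  have cond : forall (i : unit * V) (h : R), ok i h ->
      (1 - r) ^+ 2 <= dist2 r ((refl (u h) i.2) 0 ord0) /\ (1 - r) ^+ 2 <= dist2 r (ccoord ord0 i.2).
    move=> [[] y] h [[/= h0 h1] yS]; split; apply: dist2_ge => //.
      by apply: sphere_coord_le1; apply: sphere_refl => //; exact: uu.
    exact: clamp_le1.
  have eqQ (i : unit * V) (h : R) : ok i h ->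
     1 + r ^+ 2 + - (2 * r) * (ccoord ord0 i.2 + - 2 * ((Num.sqrt (1 - h ^+ 2) * ccoord j i.2 + h * ccoord ord0 i.2) * h))
     = dist2 r ((refl (u h) i.2) 0 ord0).
    case: i => [[] y] [[/= h0 h1] yS]; rewrite rfl0 yu /dist2 !ccoordE//; ring.
  apply: (jet_ext (jetM ok1 jY (jetX ok1 m.+2 (jW _)))).
    move=> i h o; split.
    - by rewrite eqQ//; case: (cond _ _ o).
    - have [_] := cond _ _ o; rewrite /dist2 => h2.
      by rewrite (_ : _ + _ * _ = 1 + r ^+ 2 - 2 * r * ccoord ord0 i.2)//; ring.
  move=> i h o.
  have eqa : 1 + r ^+ 2 + - (2 * r) * (ccoord ord0 i.2 + - 2 * ((1 * ccoord j i.2 + 0 * ccoord ord0 i.2) * 0))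
     = dist2 r (ccoord ord0 i.2) by rewrite /dist2; ring.
  rewrite eqQ// eqa -/(pole_inv_dist r i.2) /g /b.
  have [[h0 h1] yS] := o; have rS : sphere n (refl (u h) i.2) by apply: sphere_refl => //; exact: uu.
  split.
  - rewrite /pole_inv_dist /inv_dist (ccoordE ord0 rS) (ccoordE j rS) rflj yu !ccoordE//; congr (_ * _); ring.
  - by rewrite /pole_inv_dist /inv_dist; ring.
  - by rewrite /pole_inv_dist /inv_dist /=; set W := (Num.sqrt _)^-1; rewrite !exprS; field.
have [C HC] := @mean_jet unit okJ (fun _ h y => g (refl (u h) y)) (fun _ y => - g y) (fun _ y => - 2 * b y)
  (fun _ _ _ => bmeas_refl _ bg) (fun _ _ _ => bmeasN bg) (fun _ _ _ => bmeasZ _ bb) jF.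
have := @small_linear_eq0 R (\int[P]_y g y - \int[P]_y - g y) (\int[P]_y (- 2 * b y)) C.
rewrite meanZ// => H; apply/eqP; rewrite -(mulrI_eq0 _ (mulfI (_ : - 2 != 0 :> R))) ?oppr_eq0//.
apply/eqP/H => h h0 h1; rewrite -meanZ//.
by have := HC tt h (conj h0 h1); rewrite mean_refl//; exact: uu.
Qed.


Lemma mean_sum (I : Type) (s : seq I) (Q : pred I) (f : I -> V -> R) :
  (forall i, bmeas (f i)) ->
  bmeas (fun y => \sum_(i <- s | Q i) f i y) /\
  \int[P]_y (\sum_(i <- s | Q i) f i y) = \sum_(i <- s | Q i) \int[P]_y f i y.
Proof.
move=> bf; elim: s => [|i s [b1 e1]].
  rewrite big_nil (_ : (fun y => _) = fun=> 0); last by apply/funext => y; rewrite big_nil.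
  by split; [exact: bmeas_cst|rewrite mean_cst].
rewrite (_ : (fun y => _) = fun y => (if Q i then f i y else 0) + \sum_(j <- s | Q j) f j y); last first.
  by apply/funext => y; rewrite big_cons; case: ifP; rewrite ?add0r.
have bi : bmeas (fun y => if Q i then f i y else 0) by case: (Q i); [exact: bf|exact: bmeas_cst].
split; first exact: bmeasD.
by rewrite meanD// e1 big_cons; case: ifP => // _; rewrite mean_cst add0r.
Qed.

(** Sum [mean_rotation] over the [m.+1] coordinates off the axis, whose squares add up to
    [1 - ccoord ord0 y ^+ 2]. Up to sign the integrand is the spherical divergence of
    [pole_inv_dist r ^+ m.+2] times the tangential gradient of the polar coordinate. *)
Lemma mean_divergence (r : R) : 0 <= r -> r < 1 ->
  \int[P]_y (m.+1%:R * (ccoord ord0 y * pole_inv_dist r y ^+ m.+2)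
    - m.+2%:R * r * ((1 - ccoord ord0 y ^+ 2) * pole_inv_dist r y ^+ m.+4)) = 0.
Proof.
move=> r0 r1; have bw := bmeas_pole_inv_dist r0 r1.
pose f (j : 'I_n) y := ccoord ord0 y * pole_inv_dist r y ^+ m.+2 - m.+2%:R * r * (ccoord j y ^+ 2 * pole_inv_dist r y ^+ m.+4).
have bA : bmeas (fun y => ccoord ord0 y * pole_inv_dist r y ^+ m.+2).
  by apply: bmeasM; [exact: bmeas_ccoord|exact: bmeasX].
have bf j : bmeas (f j).
  apply: bmeasB => //.
  by apply: bmeasZ; apply: bmeasM; apply: bmeasX => //; exact: bmeas_ccoord.
have [bs es] := mean_sum (index_enum 'I_n) (fun j => j != ord0) bf.
rewrite (_ : \int[P]_y _ = \int[P]_y (\sum_(j | j != ord0) f j y)).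
  by rewrite es big1// => j j0; exact: mean_rotation.
apply: (mean_eq mS PS) => //.
  apply: bmeasB; first exact: bmeasZ.
  apply: bmeasZ; apply: bmeasM; last exact: bmeasX.
  by apply: bmeasB; [exact: bmeas_cst|apply: bmeasX; exact: bmeas_ccoord].
move=> y yS; rewrite /f sumrB sumr_const -mulr_sumr -mulr_suml.
have -> : \sum_(i | i != ord0) ccoord i y ^+ 2 = 1 - ccoord ord0 y ^+ 2.
  have /sphereP := yS; rewrite /dotv (bigD1 ord0)//= => <-.
  rewrite (ccoordE _ yS) expr2 [RHS]addrC addKr; apply: eq_bigr => i _.
  by rewrite (ccoordE _ yS) expr2.
rewrite (_ : #|_| = m.+1); first by congr (_ - _); exact: mulr_natl.
by have := cardC1 (ord0 : 'I_n); rewrite card_ord /= => h; rewrite -[RHS]h; apply: eq_card.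
Qed.

Section Radial.
Variables (r0 : R).
Hypotheses (r00 : 0 <= r0) (r01 : r0 < 1).

(** Keeping [r + h] below a fixed [r0 < 1] bounds the distance to the sphere from below by [1 - r0],
    which makes the remainders uniform in the radius. *)
Definition radial_step (r h : R) := [/\ 0 <= r, 0 <= h, h <= 1 & r + h <= r0].
Definition radial_pt (i : R * V) h := radial_step i.1 h /\ sphere n i.2.

Local Notation okJ := radial_step.
Local Notation ok := radial_pt.

Lemma radial_pt_le1 i h : ok i h -> `|h| <= 1.
Proof. by case=> -[_ h0 h1 _] _; rewrite ger0_norm. Qed.

Lemma jet_ccoord : jet ok (fun i _ => ccoord ord0 i.2) (fun i => ccoord ord0 i.2) (fun=> 0).
Proof. by apply: (@jet_cst _ _ _ _ 1) => i h _; exact: clamp_le1. Qed.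

Lemma jet_const (k : R) : jet ok (fun _ _ => k) (fun=> k) (fun=> 0).
Proof. by apply: (@jet_cst _ _ _ _ `|k|). Qed.

Lemma jet_radius : jet ok (fun i h => i.1 + h) (fun i => i.1) (fun=> 1).
Proof.
have j1 : jet ok (fun i _ => i.1) (fun i => i.1) (fun=> 0).
  apply: (@jet_cst _ _ _ _ 1) => i h [[r h0 h1 rh] _].
  by rewrite ger0_norm//; move: r01; lra.
by apply: (jet_ext (jetD j1 (@jet_var _ _ ok))) => i h _; split => //; rewrite ?addr0 ?add0r.
Qed.

Lemma jet_pole_inv_dist : jet ok (fun i h => pole_inv_dist (i.1 + h) i.2) (fun i => pole_inv_dist i.1 i.2)
  (fun i => - (i.1 - ccoord ord0 i.2) * pole_inv_dist i.1 i.2 ^+ 3).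
Proof.
have jq : jet ok (fun i h => dist2 (i.1 + h) (ccoord ord0 i.2)) (fun i => dist2 i.1 (ccoord ord0 i.2))
    (fun i => 2 * (i.1 - ccoord ord0 i.2)).
  apply: (jet_ext (jetD (jetD (jet_const 1) (jetX radial_pt_le1 2 jet_radius))
    (jetM radial_pt_le1 (jetM radial_pt_le1 (jet_const (- 2)) jet_radius) jet_ccoord))) => i h _.
  by rewrite /dist2 /=; split; ring.
have d0 : 0 < 1 - r0 by rewrite subr_gt0.
apply: (jet_ext (jet_isqrt radial_pt_le1 d0 jq _)) => i h [[r h0 h1 rh] yS].
  split; apply: (@dist2_ge _ r0) => //; try exact: clamp_le1; try lra.
by split => //; rewrite /pole_inv_dist /inv_dist; set W := (Num.sqrt _)^-1; field.
Qed.

(* Newton's shell theorem: the sphere exerts no force on an interior point. *)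
Lemma potential_flux : \int[P]_y (r0 ^+ m.+1 * (r0 - ccoord ord0 y) * pole_inv_dist r0 y ^+ m.+2) = 0.
Proof.
pose F r h y : R := (r + h) ^+ m.+1 * (r + h - ccoord ord0 y) * pole_inv_dist (r + h) y ^+ m.+2.
(* The derivative of the integrand in [r], after writing [(r - s)^2 W^2] as [1 - (1 - s^2) W^2] with
   [s] the polar coordinate and [W] the inverse distance. It is a multiple of the integrand of
   [mean_divergence]; the factor [r ^+ m.+1] in [F] is chosen for this. *)
pose b r y := - r ^+ m * (m.+1%:R * (ccoord ord0 y * pole_inv_dist r y ^+ m.+2)
    - m.+2%:R * r * ((1 - ccoord ord0 y ^+ 2) * pole_inv_dist r y ^+ m.+4)).
have bF r : 0 <= r -> r < 1 -> bmeas (fun y => r ^+ m.+1 * (r - ccoord ord0 y) * pole_inv_dist r y ^+ m.+2).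
  move=> p0 p1; apply: bmeasM; last by apply: bmeasX; exact: bmeas_pole_inv_dist.
  by apply: bmeasZ; apply: bmeasB; [exact: bmeas_cst|exact: bmeas_ccoord].
have bb0 r : 0 <= r -> r < 1 -> bmeas (fun y => m.+1%:R * (ccoord ord0 y * pole_inv_dist r y ^+ m.+2)
    - m.+2%:R * r * ((1 - ccoord ord0 y ^+ 2) * pole_inv_dist r y ^+ m.+4)).
  move=> p0 p1; have bw := bmeas_pole_inv_dist p0 p1; apply: bmeasB; apply: bmeasZ; apply: bmeasM.
  - exact: bmeas_ccoord.
  - exact: bmeasX.
  - by apply: bmeasB; [exact: bmeas_cst|apply: bmeasX; exact: bmeas_ccoord].
  - exact: bmeasX.
have jF : jet ok (fun i h => F i.1 h i.2) (fun i => F i.1 0 i.2) (fun i => b i.1 i.2).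
  have jm := jetM radial_pt_le1 (jet_const (- 1)) jet_ccoord.
  apply: (jet_ext (jetM radial_pt_le1 (jetM radial_pt_le1 (jetX radial_pt_le1 m.+1 jet_radius) (jetD jet_radius jm)) (jetX radial_pt_le1 m.+2 jet_pole_inv_dist))).
  move=> i h [[r h0 h1 rh] yS]; rewrite /F addr0; split.
  - by congr (_ * _); congr (_ * _); ring.
  - by congr (_ * _); congr (_ * _); ring.
  - have r1' : i.1 < 1 by move: r01; lra.
    have := inv_dist_sqr r r1' (clamp_le1 (i.2 0 ord0)); rewrite -/(ccoord _ _) -/(pole_inv_dist _ _) /dist2 /b /=.
    set s := ccoord _ _; set W := pole_inv_dist _ _; set p := i.1 => e.
    have e2 : (p - s) ^+ 2 * W ^+ 2 = 1 - (1 - s ^+ 2) * W ^+ 2.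
      transitivity ((1 + p ^+ 2 - 2 * p * s) * W ^+ 2 - (1 - s ^+ 2) * W ^+ 2); first by ring.
      by rewrite e.
    transitivity (p ^+ m * W ^+ m.+2 * (m.+1%:R * (p - s) + p)
       - m.+2%:R * p ^+ m.+1 * W ^+ m.+2 * ((p - s) ^+ 2 * W ^+ 2)).
      by rewrite !exprS; ring.
    by rewrite e2 -[m.+2]addn1 natrD !exprS; ring.
have bF1 r h : okJ r h -> bmeas (F r h).
  by move=> [p0 h0 h1 ph]; apply: bF; [exact: addr_ge0|move: r01; lra].
have bF2 r h : okJ r h -> bmeas (F r 0).
  move=> [p0 h0 h1 ph]; rewrite /F; under eq_fun do rewrite addr0.
  by apply: bF => //; move: r01; lra.
have bb r h : okJ r h -> bmeas (b r).
  by move=> [p0 h0 h1 ph]; apply: bmeasZ; apply: bb0 => //; move: r01; lra.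
have [C HC] := @mean_jet R okJ F (fun r y => F r 0 y) b bF1 bF2 bb jF.
pose Phi r := \int[P]_y (r ^+ m.+1 * (r - ccoord ord0 y) * pole_inv_dist r y ^+ m.+2).
(* The factor [r ^+ m.+1] vanishes at radius 0, which determines the constant. *)
suff : Phi r0 = Phi 0.
  rewrite /Phi => ->; under eq_Rintegral do rewrite expr0n !mul0r.
  by rewrite mean_cst.
apply: (@quadratic_const _ Phi r0 C) => //; last exact: ltW.
move=> r h p0 h0 h1 ph.
have rlt1 : r < 1 by move: r01; lra.
have := HC r h (And4 p0 h0 h1 ph).
have -> : \int[P]_y b r y = 0.
  by rewrite /b meanZ ?mean_divergence ?mulr0//; exact: bb0.
by rewrite mul0r subr0 /F /Phi; under [X in _ - X]eq_Rintegral do rewrite addr0.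
Qed.

End Radial.

(** For [r > 0] divide [potential_flux] by [r ^+ m.+1]. At [r = 0] that identity is empty, and the
    claim comes from [mean_divergence], whose second term vanishes there. *)
Lemma flux_eq0 (r : R) : 0 <= r -> r < 1 ->
  \int[P]_y ((r - ccoord ord0 y) * pole_inv_dist r y ^+ m.+2) = 0.
Proof.
move=> p0 p1; have bw := bmeas_pole_inv_dist p0 p1.
have bs : bmeas (fun y => (r - ccoord ord0 y) * pole_inv_dist r y ^+ m.+2).
  by apply: bmeasM; [apply: bmeasB; [exact: bmeas_cst|exact: bmeas_ccoord]|exact: bmeasX].
have [r_eq0|rn0] := eqVneq r 0; last first.
  have := potential_flux p0 p1; under eq_Rintegral do rewrite -mulrA.
  by rewrite meanZ// => /eqP; rewrite mulf_eq0 expf_eq0 (negPf rn0) andbF/= => /eqP.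
have := mean_divergence p0 p1.
have bc : bmeas (fun y => ccoord ord0 y * pole_inv_dist r y ^+ m.+2).
  by apply: bmeasM; [exact: bmeas_ccoord|exact: bmeasX].
rewrite r_eq0 in bc *.
under eq_Rintegral do rewrite mulr0 mul0r subr0.
rewrite meanZ// => /eqP; rewrite mulf_eq0 pnatr_eq0/= => /eqP h.
under eq_Rintegral do rewrite sub0r mulNr -mulN1r.
by rewrite meanZ// h mulr0.
Qed.

Lemma newton_potential (r0 : R) : 0 <= r0 -> r0 < 1 -> \int[P]_y (pole_inv_dist r0 y ^+ m) = 1.
Proof.
move=> r00 r01.
pose F r h y : R := pole_inv_dist (r + h) y ^+ m.
pose b r y : R := - m%:R * ((r - ccoord ord0 y) * pole_inv_dist r y ^+ m.+2).
have bF r : 0 <= r -> r < 1 -> bmeas (fun y => pole_inv_dist r y ^+ m).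
  by move=> p0 p1; apply: bmeasX; exact: bmeas_pole_inv_dist.
have bb0 r : 0 <= r -> r < 1 -> bmeas (fun y => (r - ccoord ord0 y) * pole_inv_dist r y ^+ m.+2).
  move=> p0 p1; apply: bmeasM; last by apply: bmeasX; exact: bmeas_pole_inv_dist.
  by apply: bmeasB; [exact: bmeas_cst|exact: bmeas_ccoord].
have jF : jet (radial_pt r0) (fun i h => F i.1 h i.2) (fun i => F i.1 0 i.2) (fun i => b i.1 i.2).
  apply: (jet_ext (jetX (@radial_pt_le1 r0) m (jet_pole_inv_dist r01))).
  move=> i h _; rewrite /F addr0; split => //.
  rewrite /b; set W := pole_inv_dist _ _; set s := ccoord _ _; move: W s (i.1) => W s p.
  case: (m) => [|k] /=; first by rewrite oppr0 !mul0r.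
  by rewrite !exprS; ring.
have bF1 r h : radial_step r0 r h -> bmeas (F r h).
  by move=> [p0 h0 h1 ph]; apply: bF; [exact: addr_ge0|move: r01; lra].
have bF2 r h : radial_step r0 r h -> bmeas (F r 0).
  move=> [p0 h0 h1 ph]; rewrite /F; under eq_fun do rewrite addr0.
  by apply: bF => //; move: r01; lra.
have bb r h : radial_step r0 r h -> bmeas (b r).
  by move=> [p0 h0 h1 ph]; apply: bmeasZ; apply: bb0 => //; move: r01; lra.
have [C HC] := @mean_jet R (radial_step r0) F (fun r y => F r 0 y) b bF1 bF2 bb jF.
pose B r := \int[P]_y (pole_inv_dist r y ^+ m).
have B0 : B 0 = 1.
  rewrite -[RHS](mean_cst P); apply: (mean_eq mS PS); [exact: bF|exact: bmeas_cst|] => y yS.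
  by rewrite /pole_inv_dist /inv_dist /dist2 expr0n mulr0 mul0r addr0 subr0 sqrtr1 invr1 expr1n.
rewrite -[RHS]B0; apply: (@quadratic_const _ B r0 C) => //; last exact: ltW.
move=> r h p0 h0 h1 ph.
have rlt1 : r < 1 by move: r01; lra.
have := HC r h (And4 p0 h0 h1 ph).
have -> : \int[P]_y b r y = 0.
  by rewrite /b meanZ ?flux_eq0 ?mulr0//; exact: bb0.
by rewrite mul0r subr0 /F /B; under [X in _ - X]eq_Rintegral do rewrite addr0.
Qed.

(** Since [1 - r ^+ 2 = dist2 r s - 2 * r * (r - s)], the integrand is that of [newton_potential]
    minus [2 * r] times that of [flux_eq0]. *)
Lemma poisson_mass_pole (r : R) : 0 <= r -> r < 1 ->
  \int[P]_y ((1 - r ^+ 2) * pole_inv_dist r y ^+ m.+2) = 1.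
Proof.
move=> p0 p1; have bw := bmeas_pole_inv_dist p0 p1.
have bs : bmeas (fun y => (r - ccoord ord0 y) * pole_inv_dist r y ^+ m.+2).
  by apply: bmeasM; [apply: bmeasB; [exact: bmeas_cst|exact: bmeas_ccoord]|exact: bmeasX].
have b2 := bmeasZ (2 * r) bs.
have bX : bmeas (fun y => pole_inv_dist r y ^+ m) by exact: bmeasX.
rewrite -[RHS](newton_potential p0 p1) -[RHS]subr0.
rewrite -[X in _ = _ - X](mulr0 (2 * r)) -(flux_eq0 p0 p1) -meanZ// -meanB//.
apply: (mean_eq mS PS); [by apply: bmeasZ; exact: bmeasX|exact: bmeasB|] => y yS.
have := inv_dist_sqr p0 p1 (clamp_le1 (y 0 ord0)); rewrite -/(ccoord _ _) -/(pole_inv_dist _ _) /dist2 => e.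
transitivity ((1 + r ^+ 2 - 2 * r * ccoord ord0 y) * pole_inv_dist r y ^+ 2 * pole_inv_dist r y ^+ m
  - 2 * r * ((r - ccoord ord0 y) * pole_inv_dist r y ^+ m.+2)); first by rewrite !exprS; ring.
by rewrite e mul1r.
Qed.

End PoissonMass.

(** * Polarization *)

Section Polarization.
Variables (R : realType) (n : nat).
Hypothesis n0 : (0 < n)%N.
Local Notation V := 'rV[R]_n.
Local Notation P := (sphere_prob R n).

Let mS : measurable (sphere n : set V) := @measurable_sphere R n.
Let PS : P (~` (sphere n)) = 0%E := sphere_prob_sphereC R n0.

Definition halfspace_sign (u y : V) : R := if 0 <= dotv y u then 1 else -1.

(** Half of [a + b + |a - b|] is the maximum of [a] and [b], and half of [a + b - |a - b|] the
    minimum. *)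
Definition polarize (u : V) (f : V -> R) (y : V) : R :=
  2^-1 * (f y + f (refl u y) + halfspace_sign u y * `|f y - f (refl u y)|).

Definition clamp_dotv (u y : V) : R := clamp (dotv y u).

Lemma measurable_dotvr (u : V) : measurable_fun setT (fun y : V => dotv y u).
Proof. by apply: measurable_fun_dotv => //; exact: measurable_cst. Qed.

Lemma bmeas_clamp_dotv u : bmeas (clamp_dotv u).
Proof.
split; last by exists 1 => y; exact: clamp_le1.
exact: (measurableT_comp (@measurable_clamp R) (measurable_dotvr u)).
Qed.

Lemma clamp_dotvE u y : dotv u u = 1 -> sphere n y -> clamp_dotv u y = dotv y u.
Proof.
by move=> uu yS; rewrite /clamp_dotv clamp_id// sphere_dotv_le1//; exact/sphereP.
Qed.

Lemma measurable_halfspace (u : V) (t : R) : measurable [set y : V | t <= dotv y u].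
Proof.
have := measurable_dotvr u measurableT (measurable_itv `[t, +oo[).
by rewrite setTI; congr measurable; apply/seteqP; split=> y /=; rewrite in_itv/= andbT.
Qed.

Lemma bmeas_halfspace_sign u : bmeas (halfspace_sign u).
Proof.
rewrite (_ : halfspace_sign u = fun y => 2 * \1_[set y : V | 0 <= dotv y u] y - 1).
  apply: bmeasB; last exact: bmeas_cst.
  by apply: bmeasZ; apply: bmeas_indic; exact: measurable_halfspace.
apply/funext => y; rewrite /halfspace_sign indicE; case: ifPn => [h|h].
  by rewrite mem_set//= mulr1; ring.
by rewrite memNset ?mulr0 ?sub0r// => /= h'; rewrite h' in h.
Qed.

Lemma bmeas_polarize u f : bmeas f -> bmeas (polarize u f).
Proof.
move=> bf; have bs := bmeas_refl u bf.
apply: bmeasZ; apply: bmeasD; first exact: bmeasD.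
by apply: bmeasM; [exact: bmeas_halfspace_sign|apply: bmeas_norm; exact: bmeasB].
Qed.

Section FixedReflection.
Variable u : V.
Hypothesis uu : dotv u u = 1.
Local Notation s := (refl u).

Lemma dotv_refl_u y : dotv (s y) u = - dotv y u.
Proof. by rewrite dotvC dotv_reflu// dotvC. Qed.

Lemma refl_fix y : dotv y u = 0 -> s y = y.
Proof. by move=> h; rewrite reflE h mulr0 scale0r subr0. Qed.

(** Polarization keeps or exchanges the two values at [y] and its mirror image. On the hyperplane
    the sign does not flip, but there the two points coincide. *)
Lemma polarize_sum f y : polarize u f (s y) = f y + f (s y) - polarize u f y.
Proof.
rewrite /polarize reflK// /halfspace_sign dotv_refl_u oppr_ge0 (distrC (f (s y))).
case: (ltgtP 0 (dotv y u)) => h; try by field.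
by rewrite (refl_fix (esym h)) subrr normr0; field.
Qed.

Lemma polarize_comp f y : polarize u (fun z => f (s z)) y = polarize u f y.
Proof. by rewrite /polarize reflK// (distrC (f (s y))) (addrC (f (s y))). Qed.

Lemma polarize_ge f y : 0 <= dotv y u -> f y <= polarize u f y.
Proof.
move=> h; rewrite /polarize /halfspace_sign h mul1r.
have := ler_norm (f y - f (s y)); have := ler_norm (- (f y - f (s y))); rewrite normrN.
lra.
Qed.

Lemma polarize_le f y : dotv y u < 0 -> polarize u f y <= f y.
Proof.
move=> h; rewrite /polarize /halfspace_sign ifN -?ltNge//.
have := ler_norm (f y - f (s y)); have := ler_norm (- (f y - f (s y))); rewrite normrN.
lra.
Qed.

Lemma polarize_01 f y : f y = 0 \/ f y = 1 -> f (s y) = 0 \/ f (s y) = 1 ->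
  polarize u f y = 0 \/ polarize u f y = 1.
Proof.
rewrite /polarize /halfspace_sign => -[] -> [] ->; case: ifP => _;
  rewrite ?subrr ?subr0 ?sub0r ?normrN ?normr0 ?normr1; try by [left; field|right; field].
Qed.

Lemma mean_sym (g : V -> R) : bmeas g ->
  \int[P]_y g y = 2^-1 * \int[P]_y (g y + g (s y)).
Proof. by move=> bg; rewrite meanD ?mean_refl//; [field|exact: bmeas_refl]. Qed.

Lemma mean_polarize f : bmeas f -> \int[P]_y polarize u f y = \int[P]_y f y.
Proof.
move=> bf; rewrite (mean_sym (bmeas_polarize u bf)) (mean_sym bf); congr (_ * _).
by apply: eq_Rintegral => y _; rewrite polarize_sum; ring.
Qed.

(** The change [polarize u f - f] is odd under the reflection, so only the odd part of [dotv y e]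
    counts, and that is [dotv y u * dotv u e]. *)
Lemma polarize_gain e f : bmeas f -> dotv e e = 1 ->
  \int[P]_y (clamp_dotv e y * polarize u f y) - \int[P]_y (clamp_dotv e y * f y) =
  dotv u e * \int[P]_y (clamp_dotv u y * (polarize u f y - f y)).
Proof.
move=> bf ee; have bp := bmeas_polarize u bf.
have bD : bmeas (fun y => polarize u f y - f y) by exact: bmeasB.
have bh : bmeas (clamp_dotv u) by exact: bmeas_clamp_dotv.
have bg : bmeas (fun y => clamp_dotv e y * (polarize u f y - f y)) by apply: bmeasM => //; exact: bmeas_clamp_dotv.
rewrite -meanB; [|by apply: bmeasM => //; exact: bmeas_clamp_dotv..].
rewrite -meanZ; last exact: bmeasM.
transitivity (\int[P]_y (clamp_dotv e y * (polarize u f y - f y))).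
  by apply: eq_Rintegral => y _; ring.
rewrite (mean_sym bg) -meanZ; last by apply: bmeasD => //; exact: (bmeas_refl u bg).
apply: (mean_eq mS PS).
- by apply: bmeasZ; apply: bmeasD => //; exact: (bmeas_refl u bg).
- by apply: bmeasZ; exact: bmeasM.
- move=> y yS; have sS := sphere_refl uu yS.
  by rewrite polarize_sum// !clamp_dotvE// reflE dotvDl dotvNl dotvZl; field.
Qed.

End FixedReflection.

(** * Smoothing by a reflection-invariant, monotone and Lipschitz kernel *)

Section Kernel.
Variables (K : V -> V -> R) (k0 k1 L : R).
Hypothesis bK : bmeas (fun p : V * V => K p.1 p.2).
Hypothesis Ksym : forall x y, K x y = K y x.
Hypothesis Krefl : forall u x y, dotv u u = 1 -> K (refl u x) y = K x (refl u y).
Hypotheses (k0_gt0 : 0 < k0) (Kge : forall x y, k0 <= K x y) (Kle : forall x y, K x y <= k1).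
Hypothesis Kmono : forall x y z, dotv x y <= dotv x z -> K x y <= K x z.
Hypotheses (L0 : 0 <= L)
  (KL : forall x y z, sphere n x -> sphere n y -> sphere n z ->
    `|K x y - K x z| <= L * `|dotv x y - dotv x z|).
Hypothesis Kmass : forall x, sphere n x -> \int[P]_y K x y = 1.

Definition smooth (f : V -> R) (x : V) : R := \int[P]_y (K x y * f y).

Lemma bmeas_K x : bmeas (K x).
Proof. exact: (bmeas_pair1 x bK). Qed.

Lemma bmeas_Kf x f : bmeas f -> bmeas (fun y => K x y * f y).
Proof. by move=> bf; apply: bmeasM => //; exact: bmeas_K. Qed.

Lemma bmeas_K2 f : bmeas f -> bmeas (fun p : V * V => K p.1 p.2 * f p.2).
Proof. by move=> bf; apply: bmeasM => //; exact: (bmeas_comp measurable_snd bf). Qed.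

Lemma bmeas_smooth f : bmeas f -> bmeas (smooth f).
Proof. by move=> bf; exact: (bmeas_mean2 P P (bmeas_K2 bf)). Qed.

Lemma smooth_refl u f x : dotv u u = 1 -> bmeas f ->
  smooth f (refl u x) = smooth (fun y => f (refl u y)) x.
Proof.
move=> uu bf; rewrite /smooth.
rewrite -(mean_refl uu (bmeas_Kf (refl u x) bf)).
by apply: eq_Rintegral => y _; rewrite Krefl// reflK.
Qed.

Lemma smooth_adjoint f g : bmeas f -> bmeas g ->
  \int[P]_x (f x * smooth g x) = \int[P]_y (smooth f y * g y).
Proof.
move=> bf bg.
have bF : bmeas (fun p : V * V => f p.1 * (K p.1 p.2 * g p.2)).
  by apply: bmeasM; [exact: (bmeas_comp measurable_fst bf)|exact: bmeas_K2].
transitivity (\int[P]_x \int[P]_y (f x * (K x y * g y))).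
  by apply: eq_Rintegral => x _; rewrite meanZ//; exact: bmeas_Kf.
rewrite (mean_Fubini P P bF); apply: eq_Rintegral => y _ /=.
rewrite mulrC /smooth -meanZ//; last exact: bmeas_Kf.
by apply: eq_Rintegral => x _; rewrite (Ksym y); ring.
Qed.

Lemma k1_ge0 : 0 <= k1.
Proof. by rewrite (le_trans _ (Kle 0 0))// (le_trans _ (Kge 0 0))// ltW. Qed.

Lemma smoothB f g x : bmeas f -> bmeas g -> smooth (fun y => f y - g y) x = smooth f x - smooth g x.
Proof.
move=> bf bg; rewrite /smooth -meanB; [|exact: bmeas_Kf..].
by apply: eq_Rintegral => y _; rewrite mulrBr.
Qed.

Lemma smooth_bounds f x : bmeas f -> (forall y, sphere n y -> 0 <= f y) ->
  k0 * \int[P]_y f y <= smooth f x <= k1 * \int[P]_y f y.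
Proof.
move=> bf f0; rewrite -!meanZ//; apply/andP; split; apply: (mean_le mS PS);
  try exact: bmeasZ; try exact: bmeas_Kf; by move=> y yS; rewrite ler_wpM2r ?f0.
Qed.

Lemma smooth_compl f x : bmeas f -> sphere n x -> smooth (fun y => 1 - f y) x = 1 - smooth f x.
Proof.
move=> bf xS; rewrite smoothB//; last exact: bmeas_cst.
congr (_ - _); rewrite -[RHS](Kmass xS) /smooth.
by apply: eq_Rintegral => y _; rewrite mulr1.
Qed.

Section SmoothPolarized.
Variable u : V.
Hypothesis uu : dotv u u = 1.
Local Notation s := (refl u).

Lemma dotv_sub_refl x y : dotv x y - dotv x (s y) = 2 * dotv y u * dotv x u.
Proof. by rewrite reflE dotvDr dotvNr dotvZr; ring. Qed.

Lemma K_refl_le x y : 0 <= dotv x u -> 0 <= dotv y u -> K x (s y) <= K x y.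
Proof.
move=> xu yu; apply: Kmono; rewrite -subr_ge0 dotv_sub_refl.
by rewrite !mulr_ge0.
Qed.

Lemma mean_antisym x (D : V -> R) : bmeas D -> (forall y, D (s y) = - D y) ->
  \int[P]_y (K x y * D y) = 2^-1 * \int[P]_y ((K x y - K x (s y)) * D y).
Proof.
move=> bD Ds; rewrite (mean_sym uu (bmeas_Kf x bD)); congr (_ * _).
by apply: eq_Rintegral => y _; rewrite Ds; ring.
Qed.

(* Both factors of the integrand have the sign of [dotv y u] when [0 <= dotv x u]. *)
Lemma smooth_polarize_sub f x : bmeas f ->
  smooth (polarize u f) x - smooth f x =
  2^-1 * \int[P]_y ((K x y - K x (s y)) * (polarize u f y - f y)).
Proof.
move=> bf; have bp := bmeas_polarize u bf.
rewrite -smoothB//; apply: mean_antisym; first exact: bmeasB.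
by move=> y; rewrite polarize_sum//; ring.
Qed.

Lemma bmeas_Ksub x (D : V -> R) : bmeas D -> bmeas (fun y => (K x y - K x (s y)) * D y).
Proof.
move=> bD; apply: bmeasM => //; apply: bmeasB; first exact: bmeas_K.
by apply: (bmeas_refl u); exact: bmeas_K.
Qed.

Lemma smooth_polarize_ge f x : bmeas f -> 0 <= dotv x u -> smooth f x <= smooth (polarize u f) x.
Proof.
move=> bf xu; rewrite -subr_ge0 smooth_polarize_sub// mulr_ge0//.
apply: (mean_ge0 mS PS); first by apply: bmeas_Ksub; apply: bmeasB => //; exact: bmeas_polarize.
move=> y yS; have [yu|yu] := leP 0 (dotv y u).
  by rewrite mulr_ge0// subr_ge0 ?K_refl_le// polarize_ge.
rewrite mulr_le0// subr_le0 ?polarize_le//.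
rewrite -{1}(reflK y uu) K_refl_le// dotv_refl_u// oppr_ge0 ltW//.
Qed.

(** The function [f] and its mirror image have the same polarization, so [smooth_polarize_ge]
    applies to the mirror image. *)
Lemma smooth_polarize_ge_refl f x : bmeas f -> 0 <= dotv x u ->
  smooth f (s x) <= smooth (polarize u f) x.
Proof.
move=> bf xu; rewrite smooth_refl// (le_trans (smooth_polarize_ge (bmeas_refl u bf) xu))//.
by rewrite (_ : polarize u _ = polarize u f)//; apply/funext => y; rewrite polarize_comp.
Qed.

Lemma smooth_polarize_sum f x : bmeas f ->
  smooth (polarize u f) (s x) = smooth f x + smooth f (s x) - smooth (polarize u f) x.
Proof.
move=> bf; have bp := bmeas_polarize u bf.
apply/eqP; rewrite -subr_eq0; apply/eqP.
transitivity ((smooth (polarize u f) x - smooth f x) + (smooth (polarize u f) (s x) - smooth f (s x))); first by ring.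
rewrite !smooth_polarize_sub// -mulrDr -meanD; [|by apply: bmeas_Ksub; apply: bmeasB..].
rewrite [X in _ * X](_ : _ = 0) ?mulr0// -[RHS](mean_cst P).
by apply: eq_Rintegral => y _; rewrite !Krefl// reflK//; ring.
Qed.

(** The kernel values at [y] and its mirror image differ by at most [2 * L * |<y,u>|], and
    [polarize u f - f] has the sign of [<y,u>]. The integral on the right is the one in
    [polarize_gain], so a small gain of height forces a small change of the smoothed function. *)
Lemma smooth_polarize_le f x : bmeas f -> sphere n x ->
  smooth (polarize u f) x - smooth f x <= L * \int[P]_y (clamp_dotv u y * (polarize u f y - f y)).
Proof.
move=> bf xS; have bD : bmeas (fun y => polarize u f y - f y) by apply: bmeasB => //; exact: bmeas_polarize.
have bh : bmeas (fun y => clamp_dotv u y * (polarize u f y - f y)) by apply: bmeasM => //; exact: bmeas_clamp_dotv.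
rewrite smooth_polarize_sub// -!meanZ//; last exact: bmeas_Ksub.
apply: (mean_le mS PS); [by apply: bmeasZ; exact: bmeas_Ksub|exact: bmeasZ|] => y yS.
have sS := sphere_refl uu yS; rewrite clamp_dotvE//.
have D0 : 0 <= dotv y u * (polarize u f y - f y).
  have [yu|yu] := leP 0 (dotv y u); first by rewrite mulr_ge0// subr_ge0 polarize_ge.
  by rewrite mulr_le0 ?subr_le0 ?polarize_le// ltW.
have nD : `|dotv y u| * `|polarize u f y - f y| = dotv y u * (polarize u f y - f y).
  by rewrite -normrM ger0_norm.
have xu1 : `|dotv x u| <= 1 by apply: sphere_dotv_le1 => //; exact/sphereP.
have kl := KL xS yS sS; rewrite dotv_sub_refl 2!normrM (@ger0_norm _ 2)// in kl.
set D := polarize u f y - f y in D0 nD *.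
have h1 : (K x y - K x (s y)) * D <= L * (2 * `|dotv y u| * `|dotv x u|) * `|D|.
  by rewrite (le_trans (ler_norm _))// normrM ler_wpM2r.
have h2 : L * (2 * `|dotv y u| * `|dotv x u|) * `|D| <= 2 * (L * (dotv y u * D)).
  rewrite -nD (_ : _ * _ * _ = 2 * L * (`|dotv y u| * `|D|) * `|dotv x u|); last by ring.
  rewrite (_ : 2 * (L * _) = 2 * L * (`|dotv y u| * `|D|) * 1); last by ring.
  by rewrite ler_wpM2l// !mulr_ge0.
lra.
Qed.

End SmoothPolarized.


Lemma smooth_eq f g x : bmeas f -> bmeas g -> (forall y, sphere n y -> f y = g y) ->
  smooth f x = smooth g x.
Proof.
move=> bf bg fg; apply: (mean_eq mS PS); [exact: bmeas_Kf..|] => y yS.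
by rewrite fg.
Qed.

Definition is01 (f : V -> R) := forall x, sphere n x -> f x = 0 \/ f x = 1.

Lemma is01_ge0 f x : is01 f -> sphere n x -> 0 <= f x.
Proof. by move=> f01 /f01[->|->]. Qed.

Lemma is01_le1 f x : is01 f -> sphere n x -> f x <= 1.
Proof. by move=> f01 /f01[->|->]. Qed.

Lemma is01_polarize u f : dotv u u = 1 -> is01 f -> is01 (polarize u f).
Proof. by move=> uu f01 x xS; apply: polarize_01; apply: f01 => //; exact: sphere_refl. Qed.

Lemma smooth_range (mu : R) : 0 < mu -> mu < 1 -> exists c, [/\ 0 < c, c <= 2^-1 &
  forall f x, bmeas f -> is01 f -> \int[P]_y f y = mu -> sphere n x ->
    c <= smooth f x <= 1 - c].
Proof.
move=> mu0 mu1; pose c := Num.min 2^-1 (k0 * Num.min mu (1 - mu)).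
exists c; split.
- by rewrite lt_min invr_gt0 ltr0n mulr_gt0// lt_min mu0 subr_gt0.
- by rewrite ge_min lexx.
move=> f x bf f01 fmu xS.
have c1 : c <= k0 * mu by rewrite ge_min ler_pM2l// ge_min lexx orbT.
have c2 : c <= k0 * (1 - mu) by rewrite ge_min ler_pM2l// ge_min lexx !orbT.
have /andP[h1 _] := smooth_bounds x bf (fun y => is01_ge0 f01).
have bC : bmeas (fun y => 1 - f y) by apply: bmeasB => //; exact: bmeas_cst.
have C0 y : sphere n y -> 0 <= 1 - f y by move=> yS; rewrite subr_ge0 is01_le1.
have /andP[h2 _] := smooth_bounds x bC C0.
rewrite smooth_compl// meanB// ?mean_cst ?fmu in h2; last exact: bmeas_cst.
by rewrite fmu in h1; apply/andP; split; lra.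
Qed.

(** * Energies of a function [phi] convex on the open unit interval, with slope [dphi] *)

Section Convex.
Variables (phi dphi : R -> R).
Hypotheses (mphi : measurable_fun setT phi) (phib : exists M : R, forall x, `|phi x| <= M).
Hypothesis mdphi : measurable_fun setT dphi.
Hypothesis tangent : forall a b, 0 < a < 1 -> 0 < b < 1 -> phi a + dphi a * (b - a) <= phi b.
Hypothesis dphi_mono : forall a b, 0 < a -> a <= b -> b < 1 -> dphi a <= dphi b.
Hypothesis dphi_lip : forall c, 0 < c -> exists Lam, 0 <= Lam /\
  forall a b, c <= a -> a <= b -> b <= 1 - c -> dphi b - dphi a <= Lam * (b - a).

Definition energy (f : V -> R) : R := \int[P]_x phi (smooth f x).

Lemma bmeas_phi (g : V -> R) : bmeas g -> bmeas (fun x => phi (g x)).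
Proof.
move=> [mg _]; split; first exact: measurableT_comp.
by have [M pM] := phib; exists M.
Qed.

(** The pair on the right has the same sum as [b], [c] and is more spread out. Adding the tangent
    inequalities at [b] and at [c], with [c <= b], leaves the term [(dphi b - dphi c) * (a - b)],
    which is nonnegative. *)
Lemma convex_spread a b c : 0 < b + c - a < 1 -> 0 < a < 1 -> b <= a -> c <= a ->
  phi b + phi c <= phi a + phi (b + c - a).
Proof.
wlog cb : b c / c <= b.
  move=> W; have [cb|/ltW bc] := leP c b; first exact: W.
  by rewrite (addrC b) (addrC (phi b)) => *; apply: W.
move=> /andP[d0 d1] /andP[a0 a1] ba ca.
have b01 : 0 < b < 1 by apply/andP; split; lra.
have c01 : 0 < c < 1 by apply/andP; split; lra.
have t1 : phi b + dphi b * (a - b) <= phi a by apply: tangent; rewrite // a0.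
have t2 : phi c + dphi c * (b + c - a - c) <= phi (b + c - a) by apply: tangent; rewrite // d0.
have t3 : dphi c <= dphi b by apply: dphi_mono => //; lra.
nra.
Qed.

Lemma energy_polarize u f : dotv u u = 1 -> bmeas f -> is01 f ->
  0 < \int[P]_y f y -> \int[P]_y f y < 1 -> energy f <= energy (polarize u f).
Proof.
move=> uu bf f01 m0 m1; have bp := bmeas_polarize u bf.
have [c [c0 _ crange]] := smooth_range m0 m1.
have rf x : sphere n x -> 0 < smooth f x < 1.
  by move=> xS; have /andP[] := crange f x bf f01 erefl xS; lra.
have rp x : sphere n x -> 0 < smooth (polarize u f) x < 1.
  by move=> xS; have /andP[] := crange _ x bp (is01_polarize uu f01) (mean_polarize uu bf) xS; lra.
have bpf := bmeas_phi (bmeas_smooth bf); have bpp := bmeas_phi (bmeas_smooth bp).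
rewrite /energy (mean_sym uu bpf) (mean_sym uu bpp) ler_wpM2l// ?invr_ge0//.
have main x : sphere n x -> 0 <= dotv x u -> phi (smooth f x) + phi (smooth f (refl u x)) <=
    phi (smooth (polarize u f) x) + phi (smooth (polarize u f) (refl u x)).
  move=> xS xu; have sS := sphere_refl uu xS; have := rp _ sS.
  rewrite (smooth_polarize_sum uu)// => h; apply: convex_spread => //; first exact: rp.
    exact: (smooth_polarize_ge uu).
  exact: (smooth_polarize_ge_refl uu).
apply: (mean_le mS PS).
- by apply: bmeasD => //; exact: (bmeas_refl u bpf).
- by apply: bmeasD => //; exact: (bmeas_refl u bpp).
move=> x xS; have [xu|xu] := leP 0 (dotv x u); first exact: main.
have := main _ (sphere_refl uu xS); rewrite dotv_refl_u// oppr_ge0 reflK// => /(_ (ltW xu)).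
by rewrite addrC [leRHS]addrC.
Qed.

(** Makes [dphi] of a smoothed function bounded on the whole space, while changing nothing on the
    sphere, where the values already lie in [[c, 1 - c]]. *)
Definition clip (c s : R) : R := Num.max c (Num.min (1 - c) s).

Lemma clip_range c s : c <= 2^-1 -> c <= clip c s <= 1 - c.
Proof.
move=> c2; rewrite /clip le_max lexx/= ge_max ge_min lexx/= andbT; lra.
Qed.

Lemma clip_id c s : c <= s <= 1 - c -> clip c s = s.
Proof. by move=> /andP[s1 s2]; rewrite /clip (min_idPr s2) (max_idPr s1). Qed.

Lemma clip_le c a b d : 0 <= d -> a <= b + d -> clip c a <= clip c b + d.
Proof.
move=> d0 ab; rewrite /clip ge_max; apply/andP; split.
  have : c <= Num.max c (Num.min (1 - c) b) by rewrite le_max lexx.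
  by lra.
have h : Num.min (1 - c) b <= Num.max c (Num.min (1 - c) b) by rewrite le_max lexx orbT.
rewrite (@le_trans _ _ (Num.min (1 - c) b + d)) ?lerD2r//.
have [bc|bc] := leP (1 - c) b; rewrite ge_min; apply/orP; [left|right]; lra.
Qed.

Lemma measurable_clip c : measurable_fun setT (clip c).
Proof.
apply: measurable_maxr; first exact: measurable_cst.
by apply: measurable_minr; [exact: measurable_cst|exact: measurable_id].
Qed.

Lemma dphi_clip_bound c s : 0 < c -> c <= 2^-1 ->
  `|dphi (clip c s)| <= `|dphi c| + `|dphi (1 - c)|.
Proof.
move=> c0 c2; have /andP[h1 h2] := clip_range s c2.
by apply: normr_le_bounds; apply: dphi_mono => //; lra.
Qed.

Lemma bmeas_dphi_clip c (g : V -> R) : 0 < c -> c <= 2^-1 -> measurable_fun setT g ->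
  bmeas (fun x => dphi (clip c (g x))).
Proof.
move=> c0 c2 mg; split.
  exact: (measurableT_comp mdphi (measurableT_comp (measurable_clip c) mg)).
by exists (`|dphi c| + `|dphi (1 - c)|) => x; exact: dphi_clip_bound.
Qed.

(** The error is divided by [dotv u e] because a polarization gains height in proportion to it. For
    [d = 0] the condition says that [q] does not decrease on the sphere as [dotv x e] grows. *)
Definition almost_monotone (e : V) (d : R) (q : V -> R) : Prop :=
  forall u x, dotv u u = 1 -> 0 < dotv u e -> sphere n x -> 0 <= dotv x u ->
    q (refl u x) <= q x + d / dotv u e.

Lemma almost_monotone_dphi e d c Lam q : 0 <= d -> 0 < c -> c <= 2^-1 -> 0 <= Lam ->
  (forall a b, c <= a -> a <= b -> b <= 1 - c -> dphi b - dphi a <= Lam * (b - a)) ->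
  almost_monotone e d q -> almost_monotone e (Lam * d) (fun x => dphi (clip c (q x))).
Proof.
move=> d0 c0 c2 Lam0 lip qm u x uu ue xS xu.
have dd : 0 <= d / dotv u e by rewrite divr_ge0// ltW.
have := clip_le c dd (qm u x uu ue xS xu) => h.
have /andP[a1 a2] := clip_range (q x) c2; have /andP[b1 b2] := clip_range (q (refl u x)) c2.
rewrite -mulrA.
have L1 : 0 <= Lam * (d / dotv u e) by rewrite mulr_ge0.
have [le|/ltW le] := leP (clip c (q (refl u x))) (clip c (q x)).
  have : dphi (clip c (q (refl u x))) <= dphi (clip c (q x)) by apply: dphi_mono => //; lra.
  by lra.
have := lip _ _ a1 le b2 => h1.
have : Lam * (clip c (q (refl u x)) - clip c (q x)) <= Lam * (d / dotv u e).
  by rewrite ler_wpM2l//; lra.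
by lra.
Qed.

(** Folding along the reflection gives half the mean of the kernel difference times
    [q y - q (refl u y)]. For [0 <= dotv y u] the first factor lies in [[0, k1]] and the second is
    at least [- d / dotv u e]; the other half follows by symmetry. *)
Lemma almost_monotone_smooth e d q : 0 <= d -> bmeas q ->
  almost_monotone e d q -> almost_monotone e (k1 * d) (smooth q).
Proof.
move=> d0 bq qm u x uu ue xS xu.
set dd := d / dotv u e; have dd0 : 0 <= dd by rewrite divr_ge0// ltW.
have bD : bmeas (fun y => q y - q (refl u y)) by apply: bmeasB => //; exact: bmeas_refl.
rewrite smooth_refl// -mulrA -/dd -lerBlDl -lerN2 opprB -smoothB//; last exact: bmeas_refl.
rewrite /smooth (mean_antisym uu)//; last by move=> y; rewrite reflK// opprB.
rewrite -meanZ//; last exact: bmeas_Ksub.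
rewrite -[leLHS](mean_cst P); apply: (mean_le mS PS); first exact: bmeas_cst.
  by apply: bmeasZ; exact: bmeas_Ksub.
move=> y yS; have sS := sphere_refl uu yS.
have key z : sphere n z -> 0 <= dotv z u ->
    - (k1 * dd) <= (K x z - K x (refl u z)) * (q z - q (refl u z)).
  move=> zS zu; have h := qm u z uu ue zS zu; rewrite -/dd in h.
  have K1 : 0 <= K x z - K x (refl u z) by rewrite subr_ge0 K_refl_le.
  have K2 : K x z - K x (refl u z) <= k1.
    by have := Kle x z; have := Kge x (refl u z); have := k0_gt0; lra.
  have h' : - dd <= q z - q (refl u z) by lra.
  rewrite (@le_trans _ _ ((K x z - K x (refl u z)) * - dd))//; last by rewrite ler_wpM2l.
  by rewrite mulrN lerN2 ler_wpM2r.
have kd : 0 <= k1 * dd by rewrite mulr_ge0// k1_ge0.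
suff : - (k1 * dd) <= (K x y - K x (refl u y)) * (q y - q (refl u y)) by lra.
have [yu|yu] := leP 0 (dotv y u); first exact: key.
have := key _ sS; rewrite dotv_refl_u// oppr_ge0 reflK// => /(_ (ltW yu)).
by congr (_ <= _); ring.
Qed.

(** Any two distinct points of the sphere are exchanged by a reflection, so the condition on
    reflections compares arbitrary points of different heights. The factor 2 is the inverse of the
    lower bound on [k] in [refl_exchange]. *)
Lemma almost_monotone_points e d q x y : 0 <= d -> almost_monotone e d q ->
  sphere n x -> sphere n y -> dotv y e < dotv x e ->
  q y <= q x + 2 * d / (dotv x e - dotv y e).
Proof.
move=> d0 qm xS yS yx.
have xy : x <> y by move=> xy; rewrite xy ltxx in yx.
have [u [uu uxy [k [k2 uk k0']]]] := refl_exchange xS yS xy.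
have D0 : 0 < dotv x e - dotv y e by rewrite subr_gt0.
have ue : dotv u e = k * (dotv x e - dotv y e).
  by rewrite uk dotvZl dotvDl dotvNl.
have ue0 : 0 < dotv u e by rewrite ue mulr_gt0.
have xu : 0 <= dotv x u.
  rewrite uk dotvZr mulr_ge0 ?(ltW k0')// dotvDr dotvNr subr_ge0.
  have /sphereP -> := xS.
  by have := sphere_dotv_le1 xS yS; rewrite ler_norml => /andP[].
have := qm u x uu ue0 xS xu; rewrite uxy => /le_trans; apply.
rewrite lerD2l ue invfM mulrA ler_wpM2r ?invr_ge0 ?(ltW D0)// mulrC ler_wpM2r//.
rewrite -[leRHS]invrK lef_pV2 ?posrE ?invr_gt0 ?ltr0n//.
Qed.

(** * Maximality of the cap *)

Section Halfspace.
Variables (e : V) (t : R).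
Hypothesis ee : dotv e e = 1.
Let cap : V -> R := \1_[set y : V | t <= dotv y e].

Let bcap : bmeas cap.
Proof. by apply: bmeas_indic; exact: measurable_halfspace. Qed.

Let cap01 : is01 cap.
Proof. by move=> x _; rewrite /cap indicE; case: (_ \in _); [right|left]. Qed.

Lemma capE y : cap y = if t <= dotv y e then 1 else 0.
Proof.
rewrite /cap indicE; case: ifPn => h; first by rewrite mem_set.
by rewrite memNset// => /= h'; rewrite h' in h.
Qed.

(** The layer just below the cap, whose points may be too close in height to those of the cap for
    [almost_monotone_points] to be of use. *)
Definition strip (r : R) : set V := [set y | t - r <= dotv y e] `\` [set y | t <= dotv y e].

Lemma measurable_strip r : measurable (strip r).
Proof. by apply: measurableD; exact: measurable_halfspace. Qed.

(* The bathtub principle, with [theta] an approximate value of [q] on the boundary of the cap. *)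
Lemma almost_monotone_bathtub d q Q r g : 0 <= d -> 0 < r -> bmeas q ->
  almost_monotone e d q -> (forall x, sphere n x -> `|q x| <= Q) ->
  bmeas g -> is01 g -> \int[P]_y g y = \int[P]_y cap y ->
  - (2 * d / r + 2 * Q * \int[P]_y \1_(strip r) y) <= \int[P]_y (q y * (cap y - g y)).
Proof.
move=> d0 r0 bq qm qQ bg g01 gcap.
have bw : bmeas (fun y => cap y - g y) by exact: bmeasB.
have bstrip : bmeas (\1_(strip r) : V -> R) by apply: bmeas_indic; exact: measurable_strip.
have dr : 0 <= 2 * d / r by rewrite divr_ge0 ?mulr_ge0// ltW.
(* The element [- Q] keeps the set nonempty when no point of the sphere lies below the strip. *)
pose E := [set z : R | z = - Q \/ exists x, [/\ sphere n x, dotv x e < t - r & z = q x]].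
have Eub z : E z -> z <= `|Q|.
  move=> [->|[x [xS _ ->]]]; first by rewrite -normrN ler_norm.
  by rewrite (le_trans (ler_norm _))// (le_trans (qQ _ xS))// ler_norm.
have hE : has_sup E by split; [exists (- Q); left|exists (`|Q|)].
pose theta := sup E.
have th1 x : sphere n x -> dotv x e < t - r -> q x <= theta.
  by move=> xS xt; apply: ub_le_sup; [exists (`|Q|)|right; exists x].
have th2 x : sphere n x -> t <= dotv x e -> theta <= q x + 2 * d / r.
  move=> xS xt; apply: ge_sup; first by exists (- Q); left.
  move=> z [->|[y [yS yt ->]]].
    by have := qQ _ xS; rewrite ler_norml => /andP[]; lra.
  have yx : dotv y e < dotv x e by lra.
  rewrite (le_trans (almost_monotone_points d0 qm xS yS yx))// lerD2l.
  rewrite ler_wpM2l ?mulr_ge0// lef_pV2 ?posrE//; lra.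
have thQ : - Q <= theta by apply: ub_le_sup; [exists (`|Q|)|left].
(* As [cap] and [g] have equal means, [q] may be replaced by [q - theta]. The product with [cap - g]
   is then at least [- (2 * d / r)] on the cap, nonnegative below the strip, and at least [- 2 * Q]
   on the strip. *)
have w0 : \int[P]_y (theta * (cap y - g y)) = 0 by rewrite meanZ// meanB// gcap subrr mulr0.
rewrite -[leRHS]subr0 -w0 -meanB; [|exact: bmeasM|exact: bmeasZ].
rewrite -meanZ// -[X in - (X + _)](mean_cst P) -meanD; [|exact: bmeas_cst|exact: bmeasZ].
rewrite -mulN1r -meanZ; last by apply: bmeasD; [exact: bmeas_cst|exact: bmeasZ].
apply: (mean_le mS PS).
- by apply: bmeasZ; apply: bmeasD; [exact: bmeas_cst|exact: bmeasZ].
- by apply: bmeasB; [exact: bmeasM|exact: bmeasZ].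
move=> x xS; rewrite -mulrBl capE indicE.
have := qQ _ xS; rewrite ler_norml => /andP[q1 q2].
have Q0 : 0 <= Q by rewrite (le_trans (normr_ge0 _) (qQ _ xS)).
have g0 := is01_ge0 g01 xS; have g1 := is01_le1 g01 xS.
case: ifPn => xt.
  have := th2 _ xS xt => h; rewrite memNset; last by case.
  rewrite mulr0 addr0 mulN1r.
  rewrite (@le_trans _ _ (- (2 * d / r) * (1 - g x)))//; last by rewrite ler_wpM2r; lra.
  rewrite mulNr lerN2 ler_piMr//; lra.
rewrite -ltNge in xt.
have [xr|xr] := ltP (dotv x e) (t - r).
  have h := th1 _ xS xr; rewrite memNset; last by case=> /= h' _; lra.
  rewrite mulr0 addr0 mulN1r (@le_trans _ _ 0)//; first by rewrite oppr_le0.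
  by rewrite mulr_le0; lra.
rewrite mem_set; last by split => //=; apply/negP; rewrite -ltNge.
rewrite mulr1 sub0r.
have thQ2 : theta <= Q.
  apply: ge_sup; first by exists (- Q); left.
  move=> z [->|[y [yS yt ->]]]; first lra.
  by have := qQ _ yS; rewrite ler_norml => /andP[].
nra.
Qed.

(** The strips leave out the hyperplane [dotv y e = t], so they decrease to the empty set. *)
Lemma strip_cvg0 :
  (fun k : nat => \int[P]_y \1_(strip k.+1%:R^-1) y) @ \oo --> (0 : R).
Proof.
have Pstrip k : \int[P]_y \1_(strip k.+1%:R^-1) y = fine (P (strip k.+1%:R^-1)).
  by rewrite /Rintegral integral_indic ?setIT//; exact: measurable_strip.
under eq_fun do rewrite Pstrip.
have h : P \o (fun k : nat => strip k.+1%:R^-1) @ \oo --> P (\bigcap_k strip k.+1%:R^-1).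
  apply: nonincreasing_cvg_mu.
  - rewrite (le_lt_trans (probability_le1 _ _)) ?ltry//; exact: measurable_strip.
  - by move=> k; exact: measurable_strip.
  - by apply: bigcapT_measurable => k; exact: measurable_strip.
  - move=> i j ij; apply/subsetPset => y [/= y1 y2]; split => //=.
    rewrite (le_trans _ y1)// lerB// lef_pV2 ?posrE ?ltr0n// ler_nat ltnS//.
have e0 : \bigcap_k strip k.+1%:R^-1 = set0.
  apply/seteqP; split => // y h1.
  have [_ /= /negP] := h1 0%N I; rewrite -ltNge => yt.
  have d0 : 0 < t - dotv y e by rewrite subr_gt0.
  pose k := Num.truncn (t - dotv y e)^-1.
  have [/= y1 _] := h1 k I.
  have : k.+1%:R^-1 < t - dotv y e.
    by rewrite -[ltRHS]invrK ltf_pV2 ?posrE ?invr_gt0// truncnS_gt.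
  by rewrite ltrBrDr -ltrBrDl ltNge y1.
rewrite e0 measure0 in h.
by apply: (@fine_cvg _ _ _ _ (P \o (fun k : nat => strip k.+1%:R^-1)) 0) => //.
Qed.


(* [g] almost maximizes the height [E[g(y) <y,e>]] among the sets of no smaller energy,
   so that no polarization towards [e] increases its height by more than [eps]. *)
Lemma exists_almost_monotone f eps : bmeas f -> is01 f -> 0 < \int[P]_y f y -> \int[P]_y f y < 1 ->
  0 < eps -> exists g, [/\ bmeas g, is01 g, \int[P]_y g y = \int[P]_y f y, energy f <= energy g
    & almost_monotone e (L * eps) (smooth g)].
Proof.
move=> bf f01 m0 m1 eps0.
pose cls g := [/\ bmeas g, is01 g, \int[P]_y g y = \int[P]_y f y & energy f <= energy g].
pose height g := \int[P]_y (clamp_dotv e y * g y).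
pose E := [set z : R | exists2 g, cls g & z = height g].
have bh : bmeas (clamp_dotv e) by exact: bmeas_clamp_dotv.
have hE : has_sup E.
  split; first by exists (height f); exists f.
  exists 1 => z [g [bg g01 _ _] ->]; rewrite -[leRHS](mean_cst P).
  apply: (mean_le mS PS); [exact: bmeasM|exact: bmeas_cst|] => y yS.
  rewrite (le_trans (ler_norm _))// normrM -[leRHS]mulr1 ler_pM//; first exact: clamp_le1.
  by rewrite ger0_norm ?is01_ge0 ?is01_le1.
have [z [g gc ->] gsup] := sup_adherent eps0 hE.
have [bg g01 gm gJ] := gc.
exists g; split => // u x uu ue xS xu.
have pc : cls (polarize u g).
  split; [exact: bmeas_polarize|exact: is01_polarize|by rewrite mean_polarize|].
  by apply: (le_trans gJ); apply: energy_polarize; rewrite ?gm.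
have ph : height (polarize u g) <= sup E by apply: ub_le_sup; [exact: hE.2|exists (polarize u g)].
have := polarize_gain uu bg ee; rewrite -/(height _) -/(height _) => hg.
have gain : \int[P]_y (clamp_dotv u y * (polarize u g y - g y)) <= eps / dotv u e.
  by rewrite ler_pdivlMr// mulrC -hg; lra.
have h1 := smooth_polarize_ge_refl uu bg xu.
have h2 := smooth_polarize_le uu bg xS.
have h3 : L * \int[P]_y (clamp_dotv u y * (polarize u g y - g y)) <= L * (eps / dotv u e) by rewrite ler_wpM2l.
by rewrite -mulrA; lra.
Qed.

(** The constants are fixed before [eps] and [r], which allows the limit in [eps] to be taken before
    that in [r]. Symmetry of the kernel moves the smoothing from [cap - g] to the slope [psi]. *)
Lemma energy_gap f : bmeas f -> is01 f -> 0 < \int[P]_y f y -> \int[P]_y f y < 1 ->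
  \int[P]_y f y = \int[P]_y cap y ->
  exists A Q, 0 <= A /\ forall eps r, 0 < eps -> 0 < r ->
    energy f - energy cap <= A * eps / r + Q * \int[P]_y \1_(strip r) y.
Proof.
move=> bf f01 m0 m1 fcap.
have [c [c0 c2 crange]] := smooth_range m0 m1.
have [Lam [Lam0 lip]] := dphi_lip c0.
pose M := `|dphi c| + `|dphi (1 - c)|.
have M0 : 0 <= M by rewrite addr_ge0.
(* The error [eps] is multiplied by [L] in [exists_almost_monotone], by [Lam] on passing to the
   slope, by [k1] in the second smoothing and by 2 in the bathtub estimate. The bound on
   [smooth psi] is [k1 * M]. *)
exists (2 * (k1 * (Lam * L))), (2 * (k1 * M)); split.
  by rewrite !mulr_ge0 ?k1_ge0.
move=> eps r eps0 r0.
have [g [bg g01 gm gJ gam]] := exists_almost_monotone bf f01 m0 m1 eps0.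
have bsg := bmeas_smooth bg; have bsC := bmeas_smooth bcap.
pose psi x := dphi (clip c (smooth g x)).
have bpsi : bmeas psi by apply: bmeas_dphi_clip => //; case: bsg.
have Le : 0 <= L * eps by rewrite mulr_ge0// ltW.
have apsi : almost_monotone e (Lam * (L * eps)) psi by exact: (almost_monotone_dphi Le c0 c2 Lam0).
have LLe : 0 <= Lam * (L * eps) by rewrite mulr_ge0.
have aq := almost_monotone_smooth LLe bpsi apsi.
have psiM x : `|psi x| <= M.
  exact: dphi_clip_bound.
have qQ x : sphere n x -> `|smooth psi x| <= k1 * M.
  move=> xS; rewrite /smooth (le_trans (le_normr_Rintegral _ _))//.
    by apply: bmeas_integrable; exact: bmeas_Kf.
  rewrite -[leRHS](mean_cst P); apply: (mean_le mS PS); [|exact: bmeas_cst|].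
    by apply: bmeas_norm; exact: bmeas_Kf.
  move=> y yS; rewrite normrM ler_pM// ger0_norm ?Kle//.
  by rewrite (le_trans (ltW k0_gt0)).
have kLe : 0 <= k1 * (Lam * (L * eps)) by rewrite mulr_ge0// k1_ge0.
have gcap : \int[P]_y g y = \int[P]_y cap y by rewrite gm.
have := almost_monotone_bathtub kLe r0 (bmeas_smooth bpsi) aq qQ bg g01 gcap.
have bw : bmeas (fun y => cap y - g y) by exact: bmeasB.
rewrite -smooth_adjoint// => h.
have bpg := bmeas_phi bsg; have bpC := bmeas_phi bsC.
have bt : bmeas (fun x => psi x * smooth (fun y => cap y - g y) x).
  by apply: bmeasM => //; exact: bmeas_smooth.
have : energy g + \int[P]_x (psi x * smooth (fun y => cap y - g y) x) <= energy cap.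
  rewrite /energy -(meanD _ bpg bt); apply: (mean_le mS PS (bmeasD bpg bt) bpC).
  move=> x xS; rewrite smoothB//.
  have rg := crange g x bg g01 gm xS.
  have rC := crange cap x bcap cap01 (esym fcap) xS.
  rewrite /psi clip_id//; apply: tangent.
    exact: shrunk_itv01 c0 rg.
  exact: shrunk_itv01 c0 rC.
rewrite (_ : 2 * (k1 * (Lam * L)) * eps = 2 * (k1 * (Lam * (L * eps)))); last by ring.
by move=> hJ; exact: ler_sub_chain gJ hJ h.
Qed.

Lemma energy_eq f g : bmeas f -> bmeas g -> (forall x, sphere n x -> smooth f x = smooth g x) ->
  energy f = energy g.
Proof.
move=> bf bg fg; apply: (mean_eq mS PS); [exact: bmeas_phi (bmeas_smooth _)..|] => x xS.
by rewrite fg.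
Qed.

Lemma smooth_mean0 f x : bmeas f -> is01 f -> \int[P]_y f y = 0 -> smooth f x = 0.
Proof.
move=> bf f01 f0; have := smooth_bounds x bf (fun y => is01_ge0 f01).
by rewrite f0 !mulr0 => h; apply/le_anti; rewrite andbC.
Qed.

Lemma smooth_mean1 f x : bmeas f -> is01 f -> sphere n x -> \int[P]_y f y = 1 -> smooth f x = 1.
Proof.
move=> bf f01 xS f1; have := smooth_compl bf xS.
rewrite smooth_mean0 => [h|||].
- by apply/eqP; rewrite eq_sym -subr_eq0 -h.
- by apply: bmeasB => //; exact: bmeas_cst.
- by move=> y yS; case: (f01 y yS) => ->; rewrite ?subr0 ?subrr; [right|left].
- by rewrite meanB// ?mean_cst ?f1 ?subrr//; exact: bmeas_cst.
Qed.

Theorem energy_cap_max f : bmeas f -> is01 f -> \int[P]_y f y = \int[P]_y cap y ->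
  energy f <= energy cap.
Proof.
move=> bf f01 fcap.
have m0 : 0 <= \int[P]_y f y by apply: (mean_ge0 mS PS) => // y; exact: is01_ge0.
have m1 : \int[P]_y f y <= 1.
  rewrite -[leRHS](mean_cst P); apply: (mean_le mS PS) => //; first exact: bmeas_cst.
  by move=> y; exact: is01_le1.
(* At mean 0 or 1 no control of the slope is available, but smoothing then gives the same constant
   on the sphere for [f] and for [cap]. *)
have [f0|f0] := eqVneq (\int[P]_y f y) 0.
  rewrite (energy_eq bf bcap)// => x xS.
  by rewrite !smooth_mean0// -fcap.
have [f1|f1] := eqVneq (\int[P]_y f y) 1.
  rewrite (energy_eq bf bcap)// => x xS.
  by rewrite !smooth_mean1// -fcap.
have {f0}m0 : 0 < \int[P]_y f y by rewrite lt_neqAle eq_sym f0.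
have {f1}m1 : \int[P]_y f y < 1 by rewrite lt_neqAle f1.
have [A [Q [A0 gap]]] := energy_gap bf f01 m0 m1 fcap.
have gap' r : 0 < r -> energy f - energy cap <= Q * \int[P]_y \1_(strip r) y.
  move=> r0; apply/ler_addgt0Pl => d d0.
  (* Chosen so that [A * eps / r <= d], with [A + 1] in place of [A] to allow [A = 0]. *)
  pose eps := d * r / (A + 1).
  have A1 : 0 < A + 1 by lra.
  have eps0 : 0 < eps by rewrite !mulr_gt0// invr_gt0.
  rewrite (le_trans (gap _ _ eps0 r0))// lerD2r.
  rewrite (_ : A * eps / r = A / (A + 1) * d); last by rewrite /eps; field; rewrite !gt_eqF.
  by rewrite ler_piMl ?(ltW d0)// ler_pdivrMr//; lra.
rewrite -subr_le0.
have cv : (fun k : nat => Q * \int[P]_y \1_(strip k.+1%:R^-1) y) @ \oo --> (0 : R).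
  by rewrite -(mulr0 Q); apply: cvgZr => //; exact: strip_cvg0.
have := cvg_lim (@Rhausdorff R) cv => <-.
apply: limr_ge; first by apply/cvg_ex; exists 0.
by apply: nearW => k; apply: gap'; rewrite invr_gt0.
Qed.

End Halfspace.
End Convex.
End Kernel.
End Polarization.

(** * Poisson kernel and binary entropy *)

Section BinaryEntropy.
Variable R : realType.

(** The tangent line of [ln] at [y]. The bound on [b ln b], the tangent inequality for the entropy
    and the Lipschitz bound for its slope are all obtained from it. *)
Lemma ln_sub_le (x y : R) : 0 < x -> 0 < y -> ln x - ln y <= (x - y) / y.
Proof.
move=> x0 y0; rewrite -ln_div ?posrE//.
have -> : x / y = 1 + (x - y) / y by field; rewrite gt_eqF.
apply: le_ln1Dx; rewrite mulrBl divff ?gt_eqF//.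
have : 0 < x / y by rewrite divr_gt0.
lra.
Qed.

Lemma ln2_pos : 0 < ln (2 : R).
Proof. by rewrite ln_gt0// ltr1n. Qed.

(** The derivative of [- binent] on the open unit interval, that is, the base-2 log-odds. *)
Definition dbinent (a : R) : R := (ln a - ln (1 - a)) / ln 2.

Lemma binentE (b : R) : 0 < b < 1 -> - binent b = (b * ln b + (1 - b) * ln (1 - b)) / ln 2.
Proof.
by move=> b01; rewrite /binent b01 -mulNr; congr (_ / _); ring.
Qed.

Lemma xlnx_bound (b : R) : 0 < b -> b < 1 -> 0 <= b * - ln b <= 1.
Proof.
move=> b0 b1.
have l0 : ln b <= 0 by apply: ln_le0; exact: ltW.
have l1 := ln_sub_le ltr01 b0; rewrite ln1 sub0r in l1.
apply/andP; split; first by rewrite mulr_ge0 ?oppr_ge0// ltW.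
rewrite (@le_trans _ _ (b * ((1 - b) / b)))//; first by rewrite ler_wpM2l// ltW.
by rewrite mulrCA divff ?gt_eqF// mulr1; lra.
Qed.

Lemma binent_bound (b : R) : 0 <= binent b <= 2 / ln 2.
Proof.
have l2 := ln2_pos.
rewrite /binent; case: ifPn => [/andP[b0 b1]|_]; last by rewrite lexx divr_ge0// ltW.
have /andP[h1 h2] := xlnx_bound b0 b1.
have c0 : 0 < 1 - b by lra.
have c1 : 1 - b < 1 by lra.
have /andP[h3 h4] := xlnx_bound c0 c1.
apply/andP; split; first by rewrite divr_ge0 ?addr_ge0// ltW.
by rewrite ler_pM2r ?invr_gt0//; lra.
Qed.

Lemma measurable_binent : measurable_fun setT (@binent R).
Proof.
have ml (f : R -> R) : measurable_fun setT f -> measurable_fun setT (fun x => ln (f x)).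
  by move=> mf; exact: (measurableT_comp (@measurable_ln R) mf).
have m1 : measurable_fun setT (fun b : R => 1 - b).
  by apply: measurable_funB; [exact: measurable_cst|exact: measurable_id].
have mid : measurable_fun setT (fun b : R => b) by exact: measurable_id.
rewrite (_ : @binent R = fun b => \1_(`]0, 1[ : set R) b *
   ((b * (- ln b) + (1 - b) * (- ln (1 - b))) / ln 2)).
  apply: measurable_funM; first exact: measurable_indic.
  apply: measurable_funM; last exact: measurable_cst.
  by apply: measurable_funD; apply: measurable_funM => //; apply: measurableT_comp => //; exact: ml.
apply/funext => b; rewrite /binent indicE; case: ifPn => h.
  by rewrite mem_set ?mul1r//= in_itv.
by rewrite memNset ?mul0r//= in_itv; exact/negP.
Qed.

Lemma measurable_dbinent : measurable_fun setT dbinent.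
Proof.
apply: measurable_funM; last exact: measurable_cst.
apply: measurable_funB; first exact: measurable_ln.
apply: (measurableT_comp (@measurable_ln R)).
by apply: measurable_funB; [exact: measurable_cst|exact: measurable_id].
Qed.

(** The right side minus the left is the relative entropy, in bits, of a coin of bias [b] with
    respect to one of bias [a]. *)
Lemma binent_tangent (a b : R) : 0 < a < 1 -> 0 < b < 1 ->
  - binent a + dbinent a * (b - a) <= - binent b.
Proof.
move=> a01 b01; rewrite !binentE// /dbinent.
have /andP[a0 a1] := a01; have /andP[b0 b1] := b01.
have a0' : 0 < 1 - a by lra.
have b0' : 0 < 1 - b by lra.
rewrite mulrAC -mulrDl ler_pM2r ?invr_gt0 ?ln2_pos//.
have := ln_sub_le a0 b0; have := ln_sub_le a0' b0'.
rewrite !ler_pdivlMr//; lra.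
Qed.

Lemma dbinent_mono (a b : R) : 0 < a -> a <= b -> b < 1 -> dbinent a <= dbinent b.
Proof.
move=> a0 ab b1; rewrite ler_pM2r ?invr_gt0 ?ln2_pos//.
by rewrite lerB// ler_ln ?posrE//; lra.
Qed.

Lemma dbinent_lip (c : R) : 0 < c -> exists Lam, 0 <= Lam /\
  forall a b, c <= a -> a <= b -> b <= 1 - c -> dbinent b - dbinent a <= Lam * (b - a).
Proof.
(* Each of the two logarithms is Lipschitz with constant [c^-1] where its argument is at least
   [c]. *)
move=> c0; have l2 := ln2_pos; exists (2 / c / ln 2); split.
  by rewrite !divr_ge0// ltW.
move=> a b ca ab bc; rewrite -mulrBl mulrAC ler_pM2r ?invr_gt0//.
have a0 : 0 < a by lra.
have b0 : 0 < b by lra.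
have a0' : 0 < 1 - a by lra.
have b0' : 0 < 1 - b by lra.
have h1 := ln_sub_le b0 a0; have h2 := ln_sub_le a0' b0'.
have h3 : (b - a) / a <= (b - a) / c by rewrite ler_wpM2l ?subr_ge0// lef_pV2.
have h4 : (1 - a - (1 - b)) / (1 - b) <= (b - a) / c.
  rewrite (_ : 1 - a - (1 - b) = b - a); last by ring.
  by rewrite ler_wpM2l ?subr_ge0// lef_pV2 ?posrE//; lra.
rewrite (_ : 2 / c * (b - a) = (b - a) / c + (b - a) / c); last by field; rewrite gt_eqF.
by lra.
Qed.

End BinaryEntropy.

(** * The Poisson kernel as a function of the inner product *)

Section PoissonKernel.
Variables (R : realType) (n : nat) (rho : R).
Hypotheses (r0 : 0 <= rho) (r1 : rho < 1).
Local Notation V := 'rV[R]_n.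

(* Agrees with [poisson_kernel] on the sphere only. *)
Definition clamped_poisson (x y : V) : R := (1 - rho ^+ 2) * inv_dist rho (clamp (dotv x y)) ^+ n.

Let r2 : 0 < 1 - rho ^+ 2.
Proof. by rewrite subr_gt0 expr_lt1. Qed.

Lemma clamped_poissonE x y : sphere n x -> sphere n y -> poisson_kernel rho x y = clamped_poisson x y.
Proof.
move=> xS yS; rewrite /clamped_poisson clamp_id; last exact: sphere_dotv_le1.
rewrite /poisson_kernel /inv_dist exprVn /enorm; congr (_ / Num.sqrt _ ^+ _).
move: xS yS => /sphereP xx /sphereP yy.
by rewrite !(dotvDl, dotvDr, dotvNl, dotvNr, dotvZl, dotvZr) (dotvC y x) xx yy /dist2; ring.
Qed.

Lemma bmeas_clamped_poisson : bmeas (fun p : V * V => clamped_poisson p.1 p.2).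
Proof.
apply: bmeasZ; apply: bmeasX; apply: bmeas_inv_dist => //; last by move=> p; exact: clamp_le1.
apply: (measurableT_comp (@measurable_clamp R)).
by apply: measurable_fun_dotv; [exact: measurable_fst|exact: measurable_snd].
Qed.

Lemma clamped_poisson_sym x y : clamped_poisson x y = clamped_poisson y x.
Proof. by rewrite /clamped_poisson dotvC. Qed.

Lemma clamped_poisson_refl u x y : dotv u u = 1 -> clamped_poisson (refl u x) y = clamped_poisson x (refl u y).
Proof. by move=> uu; rewrite /clamped_poisson dotv_refl_swap. Qed.

Lemma clamped_poisson_le x y : clamped_poisson x y <= (1 - rho ^+ 2) * (1 - rho)^-1 ^+ n.
Proof.
have /andP[h0 h1] := inv_dist_bound r0 r1 (clamp_le1 (dotv x y)).
by rewrite ler_pM2l// lerXn2r// nnegrE// (le_trans h0).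
Qed.

Lemma dist2_gt0 s : `|s| <= 1 -> 0 < dist2 rho s.
Proof.
by move=> s1; rewrite (lt_le_trans _ (dist2_ge r0 (lexx _) r1 s1))// exprn_gt0// subr_gt0.
Qed.

(** On the sphere the distance from [x] to [rho y] is at most [1 + rho], attained at antipodal
    points. This positive bound is what keeps smoothed indicators away from 0 and 1. *)
Lemma clamped_poisson_ge x y : (1 - rho ^+ 2) * (1 + rho)^-1 ^+ n <= clamped_poisson x y.
Proof.
have r3 : 0 < 1 + rho by move: r0; lra.
have s1 := clamp_le1 (dotv x y); set s := clamp _ in s1 *.
have q0 := dist2_gt0 s1.
rewrite /clamped_poisson -/s ler_pM2l// lerXn2r ?nnegrE ?invr_ge0 ?sqrtr_ge0 ?(ltW r3)//.
rewrite /inv_dist lef_pV2 ?posrE ?sqrtr_gt0//.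
rewrite -(ger0_norm (ltW r3)) -sqrtr_sqr ler_wsqrtr//.
move: s1; rewrite ler_norml /dist2 => /andP[h1 _].
have h2 : 0 <= s + 1 by lra.
have := mulr_ge0 r0 h2; rewrite !expr2; lra.
Qed.

Lemma clamp_mono (s s' : R) : s <= s' -> clamp s <= clamp s'.
Proof.
move=> ss; rewrite /clamp ge_max le_max lexx/= le_max; apply/orP; right.
by rewrite le_min !ge_min lexx ss/= orbT.
Qed.

Lemma clamped_poisson_mono x y z : dotv x y <= dotv x z -> clamped_poisson x y <= clamped_poisson x z.
Proof.
move=> /clamp_mono; have := clamp_le1 (dotv x y); have := clamp_le1 (dotv x z).
rewrite /clamped_poisson; set s := clamp _; set s' := clamp (dotv x y) => s1 s1' ss.
have q0 := dist2_gt0 s1; have q0' := dist2_gt0 s1'.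
rewrite ler_pM2l// lerXn2r ?nnegrE ?invr_ge0 ?sqrtr_ge0//.
rewrite /inv_dist lef_pV2 ?posrE ?sqrtr_gt0// ler_wsqrtr// /dist2 lerB//.
by rewrite ler_wpM2l// mulr_ge0.
Qed.

(** The reciprocals of [z] and [z'] differ by [(z'^2 - z^2) / (z z' (z + z'))]. The numerator is
    linear in [s - s'], and each factor of the denominator is at least [1 - rho]. *)
Lemma inv_dist_lip : exists2 L, 0 <= L & forall s s', `|s| <= 1 -> `|s'| <= 1 ->
  `|inv_dist rho s - inv_dist rho s'| <= L * `|s - s'|.
Proof.
pose d := 1 - rho; have d0 : 0 < d by rewrite subr_gt0.
have dV0 : 0 <= d^-1 by rewrite invr_ge0 ltW.
exists (2 * d^-1 ^+ 3) => [|s s' s1 s1']; first by rewrite mulr_ge0// exprn_ge0.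
have q0 := dist2_gt0 s1; have q0' := dist2_gt0 s1'.
have /andP[i0 i1] := inv_dist_bound r0 r1 s1; have /andP[i0' i1'] := inv_dist_bound r0 r1 s1'.
rewrite /inv_dist in i0 i1 i0' i1' *.
set z := Num.sqrt _ in i0 i1 *; set z' := Num.sqrt (dist2 rho s') in i0' i1' *.
have z0 : 0 < z by rewrite sqrtr_gt0.
have z0' : 0 < z' by rewrite sqrtr_gt0.
have zz : z ^+ 2 = dist2 rho s by rewrite sqr_sqrtr// ltW.
have zz' : z' ^+ 2 = dist2 rho s' by rewrite sqr_sqrtr// ltW.
have zz0 : 0 < z + z' by rewrite addr_gt0.
have -> : z^-1 - z'^-1 = 2 * rho * (s - s') * (z^-1 * z'^-1 * (z + z')^-1).
  transitivity ((z' ^+ 2 - z ^+ 2) * (z^-1 * z'^-1 * (z + z')^-1)).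
    by field; rewrite !gt_eqF.
  by rewrite zz zz' /dist2; congr (_ * _); ring.
have zd : (z + z')^-1 <= d^-1.
  rewrite (le_trans _ i1)// lef_pV2 ?posrE// lerDl ltW//.
have p0 : 0 <= z^-1 * z'^-1 * (z + z')^-1 by rewrite !mulr_ge0// invr_ge0 ltW.
have pd : z^-1 * z'^-1 * (z + z')^-1 <= d^-1 ^+ 3.
  rewrite (_ : d^-1 ^+ 3 = d^-1 * d^-1 * d^-1); last by ring.
  apply: ler_pM => //; [exact: mulr_ge0|by rewrite invr_ge0 ltW|exact: ler_pM].
set p := _ * (z + z')^-1 in p0 pd *.
rewrite normrM (ger0_norm p0) normrM (@ger0_norm _ (2 * rho)) ?mulr_ge0//.
rewrite (_ : _ * _ * p = 2 * `|s - s'| * (rho * p)); last by ring.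
rewrite [leRHS](_ : _ = 2 * `|s - s'| * (1 * d^-1 ^+ 3)); last by ring.
by rewrite ler_wpM2l ?mulr_ge0// ler_pM// ltW.
Qed.

Lemma clamped_poisson_lip : exists2 L, 0 <= L & forall x y z, sphere n x -> sphere n y -> sphere n z ->
  `|clamped_poisson x y - clamped_poisson x z| <= L * `|dotv x y - dotv x z|.
Proof.
have [L L0 HL] := inv_dist_lip.
have dV0 : 0 <= (1 - rho)^-1 by rewrite invr_ge0 subr_ge0 ltW.
have pow k : exists2 M, 0 <= M & forall s s', `|s| <= 1 -> `|s'| <= 1 ->
    `|inv_dist rho s ^+ k - inv_dist rho s' ^+ k| <= M * `|s - s'|.
  elim: k => [|k [M M0 IH]].
    by exists 0 => // s s' _ _; rewrite !expr0 subrr normr0 mul0r.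
  exists ((1 - rho)^-1 * M + L * (1 - rho)^-1 ^+ k) => [|s s' s1 s1'].
    by rewrite addr_ge0// mulr_ge0// exprn_ge0.
  have /andP[i0 i1] := inv_dist_bound r0 r1 s1; have /andP[i0' i1'] := inv_dist_bound r0 r1 s1'.
  rewrite (_ : _ - _ = inv_dist rho s * (inv_dist rho s ^+ k - inv_dist rho s' ^+ k)
    + (inv_dist rho s - inv_dist rho s') * inv_dist rho s' ^+ k); last by rewrite !exprS; ring.
  rewrite (le_trans (ler_normD _ _))// [leRHS]mulrDl lerD// normrM -?mulrA.
    by rewrite ler_pM//; [rewrite ger0_norm|exact: IH].
  rewrite [leRHS](_ : _ = L * `|s - s'| * (1 - rho)^-1 ^+ k); last by ring.
  rewrite ler_pM//; first exact: HL.
  by rewrite ger0_norm ?exprn_ge0// lerXn2r// nnegrE.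
have [M M0 HM] := pow n.
exists ((1 - rho ^+ 2) * M) => [|x y z xS yS zS]; first by rewrite mulr_ge0// ltW.
have h1 := sphere_dotv_le1 xS yS; have h2 := sphere_dotv_le1 xS zS.
rewrite /clamped_poisson !clamp_id// -mulrBr normrM (ger0_norm (ltW r2)) -mulrA ler_pM2l//.
exact: HM.
Qed.

End PoissonKernel.

(** A reflection carries the pole, for which the mass is known, to [x]. *)
Lemma clamped_poisson_mass (R : realType) (m : nat) (rho : R) (x : 'rV[R]_m.+2) : 0 <= rho -> rho < 1 ->
  sphere m.+2 x -> \int[sphere_prob R m.+2]_y clamped_poisson rho x y = 1.
Proof.
move=> r0 r1 xS; pose o : 'rV[R]_m.+2 := delta_mx 0 ord0.
have oE y : dotv o y = y 0 ord0.
  rewrite /dotv (bigD1 ord0)//= big1 ?addr0 => [|i ij]; rewrite mxE eqxx/=.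
    by rewrite ?eqxx mul1r.
  by rewrite (negPf ij) mul0r.
have oS : sphere m.+2 o by apply/sphereP; rewrite oE mxE !eqxx.
have om : \int[sphere_prob R m.+2]_y clamped_poisson rho o y = 1.
  apply: etrans (poisson_mass_pole m r0 r1); apply: eq_Rintegral => y _.
  by rewrite /clamped_poisson oE.
have [<-//|/eqP ox] := eqVneq o x.
have [u [uu <- _]] := refl_exchange oS xS ox.
rewrite -[RHS]om -[RHS](mean_refl uu); last exact: (bmeas_pair1 o (bmeas_clamped_poisson m.+2 r0 r1)).
by apply: eq_Rintegral => y _; rewrite clamped_poisson_refl.
Qed.

(** * From iterated integrals to means over the sphere *)

Section Transfer.
Variables (R : realType) (m : nat) (rho : R).
Hypotheses (r0 : 0 <= rho) (r1 : rho < 1).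
Local Notation n := m.+2.
Local Notation V := 'rV[R]_n.
Local Notation P := (sphere_prob R n).

Let mS : measurable (sphere n : set V) := @measurable_sphere R n.

(** The hypotheses constrain [f] on the sphere only; extension by zero makes it bounded and
    measurable on the whole space, as [bmeas] demands. *)
Definition on_sphere (g : V -> R) (x : V) : R := \1_(sphere n : set V) x * g x.

Lemma on_sphereE g x : sphere n x -> on_sphere g x = g x.
Proof. by move=> xS; rewrite /on_sphere indicE mem_set// mul1r. Qed.

Lemma on_sphere_eq g h : (forall x, sphere n x -> g x = h x) -> on_sphere g = on_sphere h.
Proof.
move=> gh; apply/funext => x; rewrite /on_sphere indicE.
by case: (boolP (x \in _)); rewrite ?mul0r// inE => xS; rewrite !mul1r gh.
Qed.

Lemma bmeas_on_sphere g : bmeas g -> bmeas (on_sphere g).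
Proof. by move=> bg; apply: bmeasM => //; exact: bmeas_indic. Qed.

Lemma sphereE_real g : bmeas (on_sphere g) -> (forall x, sphere n x -> 0 <= g x) ->
  sphereE g = (\int[P]_x on_sphere g x)%:E.
Proof.
move=> bg g0; rewrite sphereE_integral//; last by case: bg.
by rewrite mean_EFin.
Qed.

Lemma Prho_smooth g x : bmeas (on_sphere g) -> (forall x, sphere n x -> 0 <= g x) ->
  sphere n x -> Prho rho g x = smooth (clamped_poisson rho) (on_sphere g) x.
Proof.
move=> bg g0 xS.
have e : on_sphere (fun y => poisson_kernel rho x y * g y) =
    fun y => clamped_poisson rho x y * on_sphere g y.
  apply/funext => y; rewrite /on_sphere indicE.
  case: (boolP (y \in _)); rewrite ?mul0r ?mulr0// inE => yS.
  by rewrite !mul1r clamped_poissonE.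
have bpg : bmeas (fun y => clamped_poisson rho x y * on_sphere g y).
  by apply: bmeasM => //; exact: (bmeas_pair1 x (bmeas_clamped_poisson n r0 r1)).
rewrite /Prho sphereE_real ?e// => y yS.
rewrite mulr_ge0 ?g0// /poisson_kernel divr_ge0 ?exprn_ge0 ?enorm_ge0//.
by rewrite subr_ge0 expr_le1// ltW.
Qed.

Lemma bmeas_binent (h : V -> R) : measurable_fun setT h -> bmeas (fun x => binent (h x)).
Proof.
move=> mh; split; first exact: (measurableT_comp (@measurable_binent R)).
exists (2 / ln 2) => x; have /andP[b0 b1] := binent_bound (h x).
by rewrite ger0_norm.
Qed.

Lemma condH_energy g : bmeas (on_sphere g) -> (forall x, sphere n x -> 0 <= g x) ->
  (- condH rho g)%E = (energy (clamped_poisson rho) (fun b => - binent b) (on_sphere g))%:E.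
Proof.
move=> bg g0.
have bs := bmeas_smooth (bmeas_clamped_poisson n r0 r1) bg.
have bb : bmeas (fun x => binent (smooth (clamped_poisson rho) (on_sphere g) x)).
  by apply: bmeas_binent; case: bs.
have e : on_sphere (fun x => binent (Prho rho g x)) =
    on_sphere (fun x => binent (smooth (clamped_poisson rho) (on_sphere g) x)).
  by apply: on_sphere_eq => x xS; rewrite Prho_smooth.
rewrite /condH sphereE_real ?e; last 2 first.
- exact: bmeas_on_sphere.
- by move=> x _; have /andP[] := binent_bound (Prho rho g x).
rewrite /energy -EFinN; congr EFin.
under [RHS]eq_Rintegral do rewrite -mulN1r.
rewrite meanZ// mulN1r; congr (- _).
apply: (mean_eq mS (sphere_prob_sphereC R (ltn0Sn _))) => //; first exact: bmeas_on_sphere.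
by move=> x xS; rewrite on_sphereE.
Qed.

End Transfer.

Theorem theorem3 (R : realType) (n : nat) (f : 'rV[R]_n -> R) (rho : R)
    (eta : set 'rV[R]_n) :
  (2 <= n)%N ->
  (forall x, sphere n x -> f x = 0 \/ f x = 1) ->
  measurable_on_sphere f ->
  0 <= rho -> rho < 1 ->
  is_halfspace eta ->
  sphereE (\1_eta : 'rV[R]_n -> R) = sphereE f ->
  (- condH rho f <= - condH rho (\1_eta : 'rV[R]_n -> R))%E.
Proof.
case: n f eta => [|[|m]] f eta n2; [exact (False_ind _ (notF n2))|exact (False_ind _ (notF n2))|].
move=> f01 mf r0 r1 [a [t [a0 ->]]].
set C := \1__; set n := m.+2 in f f01 mf a t a0 C *.
have mS := @measurable_sphere R n.
have na : 0 < enorm a.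
  rewrite lt0r enorm_ge0 andbT; apply/eqP => h; move/eqP: a0; apply.
  by apply: dotv_eq0; rewrite -enorm_sqr h expr0n.
(* The pole of the cap: with a unit normal the same halfspace has threshold [t / enorm a]. *)
pose e := (enorm a)^-1 *: a.
have ee : dotv e e = 1 by rewrite dotvZl dotvZr -enorm_sqr; field; rewrite gt_eqF.
pose cap : 'rV[R]_n -> R := \1_[set y | t / enorm a <= dotv y e].
have Ccap : C = cap.
  have key x : (t / enorm a <= dotv x e) = (t <= dotv a x).
    by rewrite dotvZr (dotvC x) mulrC ler_pM2l// invr_gt0.
  by rewrite /C /cap; congr indic; apply/seteqP; split => x /=; rewrite key.
have bcap : bmeas cap by apply: bmeas_indic; exact: measurable_halfspace.
have bf : bmeas (on_sphere f).
  split; last first.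
    exists 1 => x; rewrite /on_sphere indicE; case: (boolP (x \in _)); rewrite ?mul0r ?normr0// inE.
    by rewrite mul1r => /f01[->|->]; rewrite ?normr0 ?normr1.
  have : measurable_fun (sphere n) f by move=> _ Y mY; exact: mf.
  move/(measurable_restrictT f mS); congr measurable_fun; apply/funext => x.
  by rewrite patchE /on_sphere indicE; case: ifP => _; rewrite ?mul0r ?mul1r.
have f0 x : sphere n x -> 0 <= f x by move=> /f01[->|->].
have C0 x : sphere n x -> 0 <= C x by move=> _; rewrite /C indicE.
have bC : bmeas (on_sphere C) by rewrite Ccap; exact: bmeas_on_sphere.
rewrite (sphereE_real bC C0) (sphereE_real bf f0) => -[Cf].
have le_EFin (x y : \bar R) (u v : R) : x = u%:E -> y = v%:E -> u <= v -> (x <= y)%E.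
  by move=> -> ->; rewrite lee_fin.
apply: (le_EFin _ _ _ _ (condH_energy r0 r1 bf f0) (condH_energy r0 r1 bC C0)).
have [L L0 lip] := clamped_poisson_lip n r0 r1.
have PS := sphere_prob_sphereC R (ltn0Sn m.+1).
have capC : \int[sphere_prob R n]_x on_sphere C x = \int[sphere_prob R n]_x cap x.
  by apply: (mean_eq mS PS) => // x xS; rewrite on_sphereE// Ccap.
have k0 : 0 < (1 - rho ^+ 2) * (1 + rho)^-1 ^+ n.
  by rewrite mulr_gt0 ?subr_gt0 ?expr_lt1// exprn_gt0// invr_gt0; lra.
have bK := bmeas_clamped_poisson n r0 r1.
rewrite (_ : energy _ _ (on_sphere C) = energy (clamped_poisson rho) (fun b => - binent b) cap); last first.
  rewrite /energy; apply: eq_Rintegral => x _; congr (- binent _).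
  apply: (smooth_eq (ltn0Sn _) bK) => // y yS; by rewrite on_sphereE// Ccap.
apply: (energy_cap_max (ltn0Sn _) bK (@clamped_poisson_sym _ _ _) (@clamped_poisson_refl _ _ _) k0
  (clamped_poisson_ge r0 r1) (clamped_poisson_le r0 r1) (clamped_poisson_mono r0 r1) L0 lip _ _ _
  (@measurable_dbinent R) (@binent_tangent R) (@dbinent_mono R) (@dbinent_lip R) ee bf).
- by move=> x xS; exact: clamped_poisson_mass.
- exact: (measurableT_comp _ (@measurable_binent R)).
- exists (2 / ln 2) => b; have /andP[b0 b1] := binent_bound b.
  by rewrite normrN ger0_norm.
- by move=> x xS; rewrite on_sphereE//; exact: f01.
- by rewrite -Cf capC.
Qed.
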